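(* Let $\Gamma$ be a lattice in $\mathbb{R}^n$ and $M=\mathbb{R}^n/\Gamma$. Denote the dual lattice of $\Gamma$ by $\Gamma^*$, the spectrum of the Laplace-Beltrami operator on $M$ by $\sigma(M)$, and let $$E_\Delta(\lambda)=\Big\{M\to\mathbb{C},\ x\mapsto e^{2\pi i\langle k',x\rangle}\ \Big|\ k'\in\Gamma^*,\ \|k'\|^2=-\tfrac{\lambda}{4\pi^2}\Big\}$$ be the standard generators of the eigenspace corresponding to $\lambda\in\sigma(M)$. (1) Every element of $E_\Delta(\lambda)$ is a $(\lambda,\mu)$-eigenfunction on $M$ with $\mu=\lambda$. (2) If $\mathcal{F}$ is a $(\lambda,\mu)$-eigenfamily on $M$, then there is an $f\in E_\Delta(\lambda)$ so that $\operatorname{span}_{\mathbb{C}}(\mathcal{F})=\operatorname{span}_{\mathbb{C}}\{f\}$; in particular $\lambda=\mu$ and $\operatorname{span}_{\mathbb{C}}(\mathcal{F})$ is one-dimensional.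
   Context: $M$ carries the flat metric $g$ induced from $\mathbb{R}^n$. The dual lattice is $\Gamma^*=\{k'\in\mathbb{R}^n\mid\langle k,k'\rangle\in\mathbb{Z}\ \forall k\in\Gamma\}$. $\Delta=\operatorname{div}\nabla$ is the Laplace-Beltrami operator (so $\sigma(M)\subset\mathbb{R}_{\le0}$), extended complex-linearly; the metric $g$ is extended complex-bilinearly to $T^{\mathbb{C}}M$ and $\kappa(\varphi,\psi)=g(\nabla\varphi,\nabla\psi)$. For $\lambda,\mu\in\mathbb{C}$, a smooth $f:M\to\mathbb{C}$ is a $(\lambda,\mu)$-eigenfunction if $\Delta f=\lambda f$ and $\kappa(f,f)=\mu f^2$. A set $\mathcal{F}$ of smooth functions $M\to\mathbb{C}$ is a $(\lambda,\mu)$-eigenfamily if $\Delta\varphi=\lambda\varphi$ and $\kappa(\varphi,\psi)=\mu\varphi\psi$ for all (not necessarily distinct) $\varphi,\psi\in\mathcal{F}$.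
   Formalization: In (2) the eigenfamily is assumed to contain a function that is not identically zero; the empty family and {0} satisfy the definition for all λ, μ but have zero span, so the claim fails for them. *)

(* Defs.v *)
(* MathComp-Analysis *)
From HB Require Import structures.
From mathcomp Require Import all_boot all_order all_algebra generic_quotient.
From mathcomp Require Import all_classical all_reals all_analysis.
From mathcomp Require Import complex.

Set Implicit Arguments.
Unset Strict Implicit.
Unset Printing Implicit Defensive.

Import Order.TTheory GRing.Theory Num.Theory.
Import numFieldNormedType.Exports.

Local Open Scope classical_set_scope.
Local Open Scope ring_scope.
Local Open Scope quotient_scope.
Local Open Scope complex_scope.

(* For K = R the Euclidean inner product; for K = R[i] its complex-bilinear
   (not Hermitian) extension. *)
Definition dot (K : pzRingType) (n : nat) (u v : 'rV[K]_n) : K :=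
  \sum_i u 0 i * v 0 i.

(* The norm `|x| of the library on 'rV_n is the sup norm. *)
Definition enorm (R : realType) (n : nat) (u : 'rV[R]_n) : R :=
  Num.sqrt (dot u u).

Definition cexp (R : realType) (z : R[i]) : R[i] :=
  (expR (complex.Re z))%:C *
  (cos (complex.Im z) +i* sin (complex.Im z)).

Section Lattice.
Variables (R : realType) (n : nat).

Definition is_lattice (G : set 'rV[R]_n) : Prop :=
  exists2 B : 'M[R]_n, B \in unitmx &
    G = [set x | exists z : 'rV[int]_n, x = map_mx intr z *m B].

Record lattice := Lattice {
  lattice_set : set 'rV[R]_n;
  latticeP : is_lattice lattice_set }.

Variable G : lattice.

Definition dual_lattice : set 'rV[R]_n :=
  [set k' | forall k, lattice_set G k -> dot k k' \in Num.int].

Definition lattice_rel : rel 'rV[R]_n := fun x y => `[< lattice_set G (x - y) >].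

Lemma lattice_rel_refl : reflexive lattice_rel.
Proof.
move=> x; apply/asboolP; rewrite subrr; case: (latticeP G) => B _ -> /=.
by exists 0; rewrite map_mx0 mul0mx.
Qed.

Lemma lattice_rel_sym : symmetric lattice_rel.
Proof.
suff h x y : lattice_rel x y -> lattice_rel y x.
  by move=> x y; apply/idP/idP; exact: h.
move=> /asboolP; rewrite /lattice_rel -(opprB x y) => Gxy; apply/asboolP.
move: Gxy; case: (latticeP G) => B _ -> /= [z ->].
by exists (- z); rewrite map_mxN mulNmx.
Qed.

Lemma lattice_rel_trans : transitive lattice_rel.
Proof.
move=> y x z /asboolP Gxy /asboolP Gyz; apply/asboolP.
rewrite (_ : x - z = (x - y) + (y - z)); last by rewrite addrA subrK.
move: Gxy Gyz; case: (latticeP G) => B _ -> /= [a ->] [b ->].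
by exists (a + b); rewrite map_mxD mulmxDl.
Qed.

Canonical lattice_equiv :=
  EquivRel lattice_rel lattice_rel_refl lattice_rel_sym lattice_rel_trans.

Definition torus : Type := {eq_quot lattice_equiv}.
HB.instance Definition _ := Choice.on torus.
HB.instance Definition _ := Quotient.on torus.

End Lattice.

Section EuclideanCalculus.
Variables (R : realType) (n : nat).

Definition partial (i : 'I_n) (f : 'rV[R]_n -> R) : 'rV[R]_n -> R :=
  fun x => 'D_(delta_mx 0 i) f x.

Definition smooth_real (f : 'rV[R]_n -> R) : Prop :=
  forall s : seq 'I_n, continuous (foldr partial f s) /\
    forall i x, derivable (foldr partial f s) x (delta_mx 0 i).

Definition smoothC (f : 'rV[R]_n -> R[i]) : Prop :=
  smooth_real (fun x => complex.Re (f x)) /\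
  smooth_real (fun x => complex.Im (f x)).

Definition partialC (i : 'I_n) (f : 'rV[R]_n -> R[i]) : 'rV[R]_n -> R[i] :=
  fun x => partial i (fun y => complex.Re (f y)) x +i*
           partial i (fun y => complex.Im (f y)) x.

End EuclideanCalculus.

Section FlatTorus.
Variables (R : realType) (n : nat) (G : lattice R n).

Local Notation M := (torus G).

(* The pullback to R^n along the local isometry \pi : R^n -> M. *)
Definition pullback (T : Type) (f : M -> T) : 'rV[R]_n -> T :=
  fun x => f (\pi_M x).

Definition smooth (f : M -> R[i]) : Prop := smoothC (pullback f).

(* The parallel frame e_1, ..., e_n of R^n descends to a global orthonormal
   parallel frame of M, in which complex vector fields are functions
   M -> 'rV[R[i]]_n; td i is differentiation along e_i. The pullback being
   G-periodic, the representative of p does not matter. *)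
Definition td (i : 'I_n) (f : M -> R[i]) : M -> R[i] :=
  fun p => partialC i (pullback f) (repr p).

Definition grad (f : M -> R[i]) : M -> 'rV[R[i]]_n :=
  fun p => \row_i td i f p.

Definition divergence (X : M -> 'rV[R[i]]_n) : M -> R[i] :=
  fun p => \sum_i td i (fun q => X q 0 i) p.

Definition laplacian (f : M -> R[i]) : M -> R[i] := divergence (grad f).

Definition kappa (f g : M -> R[i]) : M -> R[i] :=
  fun p => dot (grad f p) (grad g p).

Definition eigenfunction (lambda mu : R[i]) (f : M -> R[i]) : Prop :=
  [/\ smooth f,
      forall p, laplacian f p = lambda * f p &
      forall p, kappa f f p = mu * f p ^+ 2].

Definition eigenfamily (lambda mu : R[i]) (F : set (M -> R[i])) : Prop :=
  [/\ forall f, F f -> smooth f,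
      forall f, F f -> forall p, laplacian f p = lambda * f p &
      forall f g, F f -> F g -> forall p, kappa f g p = mu * (f p * g p)].

(* M is closed, so the spectrum consists of the eigenvalues, with smooth
   eigenfunctions. *)
Definition spectrum : set R[i] :=
  [set lambda | exists f : M -> R[i],
    [/\ smooth f, exists p, f p != 0 &
        forall p, laplacian f p = lambda * f p]].

Definition E_Delta (lambda : R[i]) : set (M -> R[i]) :=
  [set f | exists k' : 'rV[R]_n,
    [/\ dual_lattice G k',
        (enorm k' ^+ 2)%:C = - lambda / (4 * pi ^+ 2)%:C &
        forall x, f (\pi_M x) = cexp ((2 * pi)%:C * 'i%C * (dot k' x)%:C)]].

End FlatTorus.

Section Span.
Variables (T : Type) (K : fieldType).

Definition lin_span (F : set (T -> K)) : set (T -> K) :=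
  [set g | exists (m : nat) (c : 'I_m -> K) (f : 'I_m -> T -> K),
    (forall i, F (f i)) /\ g = (fun p => \sum_i c i * f i p)].

Definition has_dim (d : nat) (V : set (T -> K)) : Prop :=
  exists b : 'I_d -> T -> K,
    (forall c : 'I_d -> K, (forall p, \sum_i c i * b i p = 0) ->
       forall i, c i = 0) /\
    V = lin_span (range b).

End Span.

(* Main.v *)
Require Import Defs.
From HB Require Import structures.
From mathcomp Require Import all_boot all_order all_algebra.
From mathcomp Require Import generic_quotient finmap.
From mathcomp Require Import all_classical all_reals all_analysis.
From mathcomp Require Import complex ring lra.

(* Pull back to R^n.  If Lap f = lam f and <grad f, grad f> = mu f^2, the Hessian
   U of a local branch of log f has trace lam - mu and satisfies the Riccati
   equation D U = - U^2 along D = grad (log f).  Hence D (tr U^k) = - k tr U^(k+1), so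
   tr U^k = 0 for all k >= 2 because tr U is constant; then all eigenvalues of U
   vanish, and lam = mu.

   At a maximum of |f|^2 this gives lam <= 0.  Moreover
   Lap |f|^2 = 2 (lam |f|^2 + |grad f|^2) >= 0, and a periodic subharmonic
   function is harmonic, so that the gradient of |f|^2 has square zero and |f| is
   constant.  The Bochner formula for the closed, divergence-free field
   conj f * grad f, whose square is constant, shows that it is parallel, so that
   f is a multiple of a plane wave.  Two plane waves with wave vectors t and s in
   one family satisfy <t, s> = |t|^2 = |s|^2, whence t = s. *)

Set Implicit Arguments.
Unset Strict Implicit.
Unset Printing Implicit Defensive.

Import Order.TTheory GRing.Theory Num.Theory.
Import numFieldNormedType.Exports.

Local Open Scope classical_set_scope.
Local Open Scope ring_scope.

(** * One-variable calculus along lines *)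

Section Lines.
Variables (R : realType) (n : nat).
Implicit Types (f : 'rV[R]_n -> R) (x v : 'rV[R]_n).

(** Both difference quotients are the same function of [h], so the mean value theorem and the test
    for maxima carry over from the real line. *)
Lemma is_derive_line f x v (s : R) : derivable f (x + s *: v) v ->
  is_derive s 1 (fun t : R => f (x + t *: v)) ('D_v f (x + s *: v)).
Proof.
have E : (fun h : R => h^-1 *: (((fun t : R => f (x + t *: v)) \o shift s) (h *: (1 : R))
                       - f (x + s *: v))) =
    (fun h : R => h^-1 *: ((f \o shift (x + s *: v)) (h *: v) - f (x + s *: v))).
  apply/funext => h /=; congr (_ *: (f _ - _)).
  by rewrite [h *: 1]mulr1 scalerDl addrCA.
by move=> df; split; rewrite /derivable /derive [X in X @ _]E.
Qed.

Lemma growth_translate f a x v :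
  (fun h : R => h^-1 *: (((fun y => f (y + a)) \o shift x) (h *: v) - f (x + a))) =
  (fun h : R => h^-1 *: ((f \o shift (x + a)) (h *: v) - f (x + a))).
Proof. by apply/funext => h /=; rewrite addrA. Qed.

Lemma derive_translate f a v :
  'D_v (fun y => f (y + a)) = fun x => 'D_v f (x + a).
Proof. by apply/funext => x; rewrite /derive [X in X @ _]growth_translate. Qed.

Lemma derivable_translate f a x v :
  derivable f (x + a) v -> derivable (fun y => f (y + a)) x v.
Proof. by rewrite /derivable [X in _ -> cvg (X @ _)]growth_translate. Qed.

Lemma line_MVT f x v (h : R) : 0 < h ->
  (forall s, derivable f (x + s *: v) v) ->
  exists2 c, 0 < c < h & f (x + h *: v) - f x = h * 'D_v f (x + c *: v).
Proof.
move=> h0 df.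
have D s := is_derive_line (df s).
have [|c] := @MVT R (fun t => f (x + t *: v)) (fun s => 'D_v f (x + s *: v)) 0 h h0
  (fun s _ => D s).
  apply/continuous_subspaceT => s.
  apply/differentiable_continuous/derivable1_diffP.
  by case: (D s).
rewrite in_itv /= scale0r addr0 subr0 mulrC => ch E.
by exists c.
Qed.

(** Were the second derivative positive, the first, which vanishes at [x], would be positive just
    beyond [x]; by the mean value theorem [f] would then exceed its maximum. *)
Lemma line_max2 f x v :
  (forall s, derivable f (x + s *: v) v) ->
  (forall s, derivable ('D_v f) (x + s *: v) v) ->
  (forall s, f (x + s *: v) <= f x) ->
  'D_v f x = 0 /\ 'D_v ('D_v f) x <= 0.
Proof.
move=> df ddf fmax.
have D s := is_derive_line (df s).
have E0 : 'D_v f x = 0.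
  have i0 : (0 : R) \in `]-1, 1[ by rewrite in_itv /= ltrN10 ltr01.
  have le11 : -1 <= 1 :> R by rewrite (le_trans (lerN10 R)) ?ler01.
  have [t _|t _|_ d0] := @derive1_at_max R (fun t => f (x + t *: v)) _ _ _ le11 _ i0.
  - by case: (D t).
  - by rewrite scale0r addr0.
  by rewrite -d0; case: (D 0) => _ ->; rewrite scale0r addr0.
split => //; rewrite leNgt; apply/negP => pos.
have : \forall h \near (0 : R)^', 0 < h^-1 *: ('D_v f (h *: v + x) - 'D_v f x).
  case: (is_derive_line (ddf 0)); rewrite scale0r addr0.
  have := ddf 0; rewrite scale0r addr0 => dg _ _.
  exact: (cvgr_gt _ dg).
move=> /nbhs_ballP [e /= e0 He].
(* The length [e / 2] keeps the intermediate point [c] inside the ball where the difference quotient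
   of the first derivative is positive. *)
have [|c /andP[c0 ce]] := @line_MVT f x v (e / 2) _ df; first by rewrite divr_gt0.
have ce' : ball 0 e c by rewrite /ball /= sub0r normrN gtr0_norm //; lra.
have := He _ ce' (lt0r_neq0 c0).
rewrite E0 subr0 addrC => gp E.
have gpos : 0 < 'D_v f (x + c *: v).
  by move: gp; rewrite /GRing.scale /= pmulr_rgt0 // invr_gt0.
have := fmax (e / 2); rewrite -subr_le0 E leNgt pmulr_rgt0 ?gpos //.
by rewrite divr_gt0.
Qed.

End Lines.

(** * Algebra of smooth real functions and symmetry of second derivatives *)

Section SmoothReal.
Variables (R : realType) (n : nat).
Local Notation V := 'rV[R]_n.
Local Notation e i := (delta_mx 0 i : V).
Implicit Types (f g : V -> R) (x : V).

(** Coinduction for smoothness: a class of continuous, partially derivable functions that is stable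
    under partial derivatives contains all iterated partials of its members. *)
Lemma smooth_real_coind (S : set (V -> R)) f :
  (forall g, S g -> continuous g /\ forall i x, derivable g x (e i)) ->
  (forall g i, S g -> S (partial i g)) -> S f -> smooth_real f.
Proof.
move=> S0 S1 Sf s; apply: S0.
by elim: s => //= i s; exact: S1.
Qed.

Lemma smooth_real_continuous f : smooth_real f -> continuous f.
Proof. by move=> /(_ [::]) []. Qed.

Lemma smooth_real_derivable f i x : smooth_real f -> derivable f x (e i).
Proof. by move=> /(_ [::]) [] _; apply. Qed.

Lemma smooth_real_partial f i : smooth_real f -> smooth_real (partial i f).
Proof. by move=> sf s; have := sf (rcons s i); rewrite foldr_rcons. Qed.

Lemma partialD f g i : smooth_real f -> smooth_real g ->
  partial i (f + g) = partial i f + partial i g.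
Proof.
move=> sf sg; apply/funext => x.
by rewrite /partial deriveD //; exact: smooth_real_derivable.
Qed.

(** Products alone are not stable under [partial], since the Leibniz rule produces sums; the closure
    under both operations is stable, as [smooth_real_coind] demands. *)
Inductive smooth_gen : (V -> R) -> Prop :=
| SmoothBase f of smooth_real f : smooth_gen f
| SmoothAdd f g of smooth_gen f & smooth_gen g : smooth_gen (f + g)
| SmoothMul f g of smooth_gen f & smooth_gen g : smooth_gen (f * g).

Lemma smooth_genP f : smooth_gen f ->
  [/\ continuous f, forall i x, derivable f x (e i) &
      forall i, smooth_gen (partial i f)].
Proof.
elim=> {f} [f sf|f g gf [cf df pf] gg [cg dg pg]|f g gf [cf df pf] gg [cg dg pg]].
- split=> [|i x|i].
  + exact: smooth_real_continuous.
  + exact: smooth_real_derivable.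
  + exact/SmoothBase/smooth_real_partial.
- split=> [x|i x|i].
  + by apply: continuousD; [exact: cf|exact: cg].
  + exact: derivableD.
  + suff -> : partial i (f + g) = partial i f + partial i g by exact: SmoothAdd.
    by apply/funext => x; rewrite /partial deriveD.
- split=> [x|i x|i].
  + by apply: continuousM; [exact: cf|exact: cg].
  + exact: derivableM.
  + suff -> : partial i (f * g) = f * partial i g + g * partial i f.
      by apply: SmoothAdd; exact: SmoothMul.
    by apply/funext => x; rewrite /partial deriveM.
Qed.

Lemma smooth_gen_smooth f : smooth_gen f -> smooth_real f.
Proof.
by apply: smooth_real_coind => [g /smooth_genP[]|g i /smooth_genP[]].
Qed.

Lemma smooth_realD f g : smooth_real f -> smooth_real g -> smooth_real (f + g).
Proof.
by move=> sf sg; apply/smooth_gen_smooth/SmoothAdd; exact: SmoothBase.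
Qed.

Lemma smooth_realM f g : smooth_real f -> smooth_real g -> smooth_real (f * g).
Proof.
by move=> sf sg; apply/smooth_gen_smooth/SmoothMul; exact: SmoothBase.
Qed.

Lemma smooth_real_cst c : smooth_real (cst c : V -> R).
Proof.
apply: (@smooth_real_coind [set cst a | a in setT]); last by exists c.
  move=> _ [a _ <-]; split=> [|i x]; first exact: cst_continuous.
  exact: derivable_cst.
move=> _ i [a _ <-]; exists 0 => //; apply/funext => x.
by rewrite /partial derive_cst.
Qed.

Lemma smooth_realN f : smooth_real f -> smooth_real (- f).
Proof.
move=> sf; suff -> : - f = cst (-1) * f.
  exact: smooth_realM (smooth_real_cst _) sf.
by apply/funext => x; rewrite [RHS]mulN1r.
Qed.

Lemma partialN f i : smooth_real f -> partial i (- f) = - partial i f.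
Proof.
move=> sf; apply/funext => x.
by rewrite /partial deriveN //; exact: smooth_real_derivable.
Qed.

Lemma partialM f g i : smooth_real f -> smooth_real g ->
  partial i (f * g) = partial i f * g + f * partial i g.
Proof.
move=> sf sg; apply/funext => x.
rewrite /partial deriveM /=; [|exact: smooth_real_derivable..].
by rewrite addrC; congr (_ + _); rewrite mulrC.
Qed.

Lemma smooth_real_translate f a :
  smooth_real f -> smooth_real (fun x => f (x + a)).
Proof.
move=> sf; apply: (@smooth_real_coind
  [set fun x => g (x + a) | g in @smooth_real R n]); last by exists f.
  move=> _ [g sg <-]; split=> [x|i x].
    apply: continuous_comp; last exact: smooth_real_continuous.
    by apply: continuousD; [exact: cvg_id|exact: cst_continuous].
  exact/derivable_translate/smooth_real_derivable.
move=> _ i [g sg <-]; exists (partial i g); first exact: smooth_real_partial.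
by rewrite /partial derive_translate.
Qed.

Lemma partial_translate f a i :
  partial i (fun x => f (x + a)) = fun x => partial i f (x + a).
Proof. by rewrite /partial derive_translate. Qed.

(** The mean value theorem is used twice: along [e i] for the increment [g] of [f] in direction
    [e j], then along [e j] for [partial i f]. *)
Lemma second_difference f i j x (h : R) : smooth_real f -> 0 < h ->
  exists a b, [/\ 0 < a < h, 0 < b < h &
    f (x + h *: e i + h *: e j) - f (x + h *: e i) - f (x + h *: e j) + f x =
    h ^+ 2 * partial j (partial i f) (x + a *: e i + b *: e j)].
Proof.
move=> sf h0.
pose g y := f (y + h *: e j) - f y.
have sg : smooth_real g.
  exact: smooth_realD (smooth_real_translate _ sf) (smooth_realN sf).
have [a ah Ea] : exists2 a, 0 < a < h &
    g (x + h *: e i) - g x = h * partial i g (x + a *: e i).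
  by apply: line_MVT => // s; exact: smooth_real_derivable.
have sfi := smooth_real_partial i sf.
have [b bh Eb] : exists2 b, 0 < b < h &
    partial i f (x + a *: e i + h *: e j) - partial i f (x + a *: e i) =
    h * partial j (partial i f) (x + a *: e i + b *: e j).
  by apply: line_MVT => // s; exact: smooth_real_derivable.
exists a, b; split=> //.
have Eg : partial i g (x + a *: e i) =
    partial i f (x + a *: e i + h *: e j) - partial i f (x + a *: e i).
  transitivity (partial i ((fun y => f (y + h *: e j)) + (- f)) (x + a *: e i)).
    by [].
  rewrite partialD; [|exact: smooth_real_translate|exact: smooth_realN].
  by rewrite (partialN _ sf) partial_translate.
have -> : f (x + h *: e i + h *: e j) - f (x + h *: e i) - f (x + h *: e j) + f x =
   g (x + h *: e i) - g x by rewrite /g opprB -[LHS]addrA [- _ + f x]addrC.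
by rewrite Ea Eg Eb mulrA expr2.
Qed.

(* Schwarz: both iterated derivatives are values at nearby points of the same
   second difference quotient. *)
Lemma partial_schwarz f i j : smooth_real f ->
  partial i (partial j f) = partial j (partial i f).
Proof.
move=> sf; apply/funext => x; apply/eqP; rewrite -subr_eq0 -normr_le0.
apply/ler_addgt0Pr => eps eps0; rewrite add0r.
have c1 := smooth_real_continuous (smooth_real_partial i (smooth_real_partial j sf)).
have c2 := smooth_real_continuous (smooth_real_partial j (smooth_real_partial i sf)).
have e20 : 0 < eps / 2 by rewrite divr_gt0.
have near_lim (F : V -> R) k l : continuous F -> exists2 d, 0 < d & forall a b : R,
    0 < a < d -> 0 < b < d -> `|F x - F (x + a *: e k + b *: e l)| < eps / 2.
  move=> cF; have /cvgr_dist_lt /(_ _ e20) /nbhs_ballP [d /= d0 dH] := cF x.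
  (* Basis vectors have norm at most 1, so two displacements shorter than [d / 2] stay together
     inside the ball of radius [d]. *)
  exists (d / 2); first by rewrite divr_gt0.
  move=> a b /andP[a0 ad] /andP[b0 bd]; apply: dH.
  have nrm m : `|e m| <= 1.
    rewrite [leLHS]mx_normrE; apply: bigmax_le => // -[p q] _ /=; rewrite mxE /=.
    by case: (_ && _); rewrite ?normr1 ?normr0 ?ler01.
  rewrite -ball_normE /= opprD addrA opprD addrA subrr add0r -opprD normrN.
  rewrite (le_lt_trans (ler_normD _ _)) // !normrZ !gtr0_norm //.
  have := nrm k; have := nrm l; set u := `|_|; set v := `|_| => Hu Hv.
  have : a * v <= a * 1 by rewrite ler_wpM2l // ltW.
  have : b * u <= b * 1 by rewrite ler_wpM2l // ltW.
  by lra.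
have [d1 d10 H1] := near_lim _ j i c1.
have [d2 d20 H2] := near_lim _ i j c2.
pose h := Num.min d1 d2.
have h0 : 0 < h by rewrite lt_min d10.
have hd1 : h <= d1 by rewrite ge_min lexx.
have hd2 : h <= d2 by rewrite ge_min lexx orbT.
have [a [b [/andP[a0 ah] /andP[b0 bh] E1]]] := second_difference j i x sf h0.
have [c [d [/andP[c0 ch] /andP[d0 dh] E2]]] := second_difference i j x sf h0.
have {}H1 := H1 a b; have {}H2 := H2 c d.
rewrite a0 b0 (lt_le_trans ah hd1) (lt_le_trans bh hd1) in H1.
rewrite c0 d0 (lt_le_trans ch hd2) (lt_le_trans dh hd2) in H2.
have {}H1 := H1 isT isT; have {}H2 := H2 isT isT.
have E : partial i (partial j f) (x + a *: e j + b *: e i) =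
         partial j (partial i f) (x + c *: e i + d *: e j).
  apply: (@mulfI _ (h ^+ 2)); first by rewrite expf_neq0 // gt_eqF.
  have sw : x + h *: e j + h *: e i = x + h *: e i + h *: e j by rewrite addrAC.
  rewrite sw in E1; apply: etrans (esym E1) (etrans _ E2).
  by congr (_ + _); exact: addrAC.
rewrite E in H1.
have tri (p q r : R) : `|p - r| < eps / 2 -> `|q - r| < eps / 2 -> `|p - q| <= eps.
  move=> /ltW pr /ltW qr; apply: le_trans (ler_distD r p q) _.
  by rewrite (distrC r q) (splitr eps); exact: lerD.
exact: tri H1 H2.
Qed.

(** The function is constant on every line parallel to an axis, and [x] is reached from [y] by
    changing one coordinate at a time. *)
Lemma partial0_cst f : smooth_real f -> (forall i x, partial i f x = 0) ->
  forall x y, f x = f y.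
Proof.
move=> sf pf0.
have step i x (c : R) : f (x + c *: e i) = f x.
  rewrite -[in RHS](addr0 x) -(scale0r (e i)).
  apply: (is_derive_0_is_cst (f := fun t => f (x + t *: e i))) => s.
  have := is_derive_line (@smooth_real_derivable f i (x + s *: e i) sf).
  by rewrite [X in is_derive _ _ _ X]pf0.
move=> x y; rewrite -(subrK y x) [x - y]row_sum_delta addrC.
elim/big_rec: _ => [|i v _ IH]; first by rewrite addr0.
by rewrite addrCA addrC step.
Qed.

End SmoothReal.

(** * Matrices whose powers have trace zero *)

Section TracePowers.

Lemma trig_exp (K : comPzRingType) n (T : 'M[K]_n) k : is_trig_mx T ->
  is_trig_mx (T ^+ k) /\ forall i, (T ^+ k) i i = T i i ^+ k.
Proof.
move=> /is_trig_mxP trT; elim: k => [|k [/is_trig_mxP trk dk]].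
  split=> [|i]; last by rewrite !expr0 mxE eqxx.
  by apply/is_trig_mxP => i j ij; rewrite mxE -val_eqE ltn_eqF.
split=> [|i].
  apply/is_trig_mxP => i j ij; rewrite exprS mxE big1 // => l _.
  have [il|li] := ltnP i l; first by rewrite trT // mul0r.
  by rewrite [X in _ * X]trk ?mulr0 // (leq_ltn_trans li).
rewrite !exprS mxE (bigD1 i) //= dk big1 ?addr0 // => l li.
have [il|le] := ltnP i l; first by rewrite trT // mul0r.
by rewrite [X in _ * X]trk ?mulr0 // ltn_neqAle le andbT.
Qed.

(** By linearity the sum of [d i ^+ 2 * q.[d i]] vanishes for every polynomial [q]; a suitable [q]
    isolates one nonzero value, whose multiplicity is nonzero in characteristic 0. *)
Lemma power_sums_eq0 (K : numFieldType) (I : finType) (d : I -> K) :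
  (forall k, \sum_i d i ^+ k.+2 = 0) -> forall i, d i = 0.
Proof.
move=> p0 i0; apply/eqP/negPn/negP => di0.
have pol (q : {poly K}) : \sum_i d i ^+ 2 * q.[d i] = 0.
  under eq_bigr do rewrite horner_coef mulr_sumr.
  rewrite exchange_big big1 //= => j _.
  under eq_bigr do rewrite mulrCA -exprD.
  by rewrite -mulr_sumr p0 mulr0.
(* This polynomial kills every value other than [d i0], so that only copies of the term at [i0]
   survive. *)
pose q := \prod_(i | d i != d i0) ('X - (d i)%:P).
have qE i : q.[d i] = if d i == d i0 then q.[d i0] else 0.
  case: ifPn => [/eqP-> //|ne]; rewrite horner_prod (bigD1 i) //=.
  by rewrite !hornerE subrr mul0r.
have q0 : q.[d i0] != 0.
  rewrite horner_prod; apply/prodf_neq0 => i ne.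
  by rewrite !hornerE subr_eq0 eq_sym.
have := pol q; under eq_bigr do rewrite qE (fun_if (fun x => _ * x)) mulr0.
rewrite -big_mkcond /= (eq_bigr (fun _ => d i0 ^+ 2 * q.[d i0])); last first.
  by move=> i /eqP ->.
rewrite sumr_const => /eqP.
rewrite mulrn_eq0 mulf_eq0 expf_eq0 /= (negPf di0) (negPf q0) !orbF.
by move=> /eqP c0; have := card0_eq c0 i0; rewrite [_ \in _]eqxx.
Qed.

(** After Schur triangularization the traces of powers are power sums of the diagonal entries, which
    must all be zero. *)
Lemma mxtrace_powers_eq0 (K : numClosedFieldType) n (M : 'M[K]_n) :
  (forall k, \tr (M ^+ k.+2) = 0) -> \tr M = 0.
Proof.
case: n M => [M _|n M trM]; first by rewrite /mxtrace big_ord0.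
have [P Pu] := Schur M (ltn0Sn n); rewrite /similar_to => trT.
have Pi : P \in unitmx := unitarymx_unit Pu.
set T := conjmx P M in trT.
have TE k : T ^+ k = P *m (M ^+ k) *m invmx P.
  elim: k => [|k IH]; first by rewrite !expr0 mulmx1 mulmxV.
  by rewrite !exprS IH /T conjumx // -!mulmxE -!mulmxA mulKmx.
have trE k : \tr (T ^+ k) = \tr (M ^+ k).
  by rewrite TE mxtrace_mulC mulmxA mulVmx // mul1mx.
have d0 : forall i, T i i = 0.
  apply: power_sums_eq0 => k; rewrite -[RHS](trM k) -trE.
  by apply: eq_bigr => i _; rewrite (trig_exp _ trT).2.
by rewrite -[M]expr1 -trE expr1; apply: big1.
Qed.

End TracePowers.

(** * The Riccati equation of the logarithmic Hessian, in a commutative ring with commuting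
    derivations *)

Section Eikonal.
Variables (A : comPzRingType) (n : nat) (d : 'I_n -> A -> A).
Hypothesis dD : forall i x y, d i (x + y) = d i x + d i y.
Hypothesis dM : forall i x y, d i (x * y) = d i x * y + x * d i y.
Hypothesis dC : forall i j x, d i (d j x) = d j (d i x).
Hypothesis torsion_free : forall k (x : A), x *+ k.+1 = 0 -> x = 0.
Variables f lam mu : A.
Hypothesis dmu : forall i, d i mu = 0.
Hypothesis eikonal : \sum_i d i f * d i f = mu * f ^+ 2.
Hypothesis laplace : \sum_i d i (d i f) = lam * f.

Let d0 i : d i 0 = 0.
Proof. by apply: (addrI (d i 0)); rewrite -dD !addr0. Qed.

Let dN i x : d i (- x) = - d i x.
Proof. by apply: (addrI (d i x)); rewrite -dD !subrr d0. Qed.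

Let dsum i (F : 'I_n -> A) : d i (\sum_k F k) = \sum_k d i (F k).
Proof. exact: (big_morph _ (dD i) (d0 i)). Qed.

Local Notation T i := (d i f).
Local Notation H i j := (d i (d j f)).

(** Differentiating the eikonal equation gives twice this identity; the factor 2 is removed by
    [torsion_free]. *)
Let hess_grad i : \sum_k T k * H k i = mu * f * T i.
Proof.
apply/eqP; rewrite -subr_eq0; apply/eqP/(torsion_free (k := 1)).
have /(congr1 (d i)) := eikonal; rewrite dsum.
under eq_bigr do rewrite dM [d i (d _ f)]dC.
rewrite dM dmu mul0r add0r expr2 dM big_split /= => E.
rewrite mulr2n; apply/eqP; rewrite addrACA -opprD subr_eq0; apply/eqP.
transitivity (\sum_k T k * H k i + \sum_k H k i * T k).
  by congr (_ + _); apply: eq_bigr => k _; rewrite mulrC.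
rewrite addrC E; ring.
Qed.

(** The derivation [f * D], where [D] differentiates along the gradient of [log f]; this form needs
    no division by [f]. *)
Definition along x := \sum_k T k * d k x.

Let alongD x y : along (x + y) = along x + along y.
Proof.
by rewrite /along -big_split; apply: eq_bigr => k _; rewrite dD mulrDr.
Qed.

Let along0 : along 0 = 0.
Proof. by apply: (addrI (along 0)); rewrite -alongD !addr0. Qed.

Let alongM x y : along (x * y) = along x * y + x * along y.
Proof.
rewrite /along mulr_suml mulr_sumr -big_split; apply: eq_bigr => k _ /=.
rewrite dM; ring.
Qed.

Let alongN x : along (- x) = - along x.
Proof. by rewrite /along -sumrN; apply: eq_bigr => k _; rewrite dN mulrN. Qed.

(** This is the derivative of [hess_grad]; commuting the derivations turns the third-order terms
    into [along (H i j)]. *)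
Let along_hess i j :
  along (H i j) = mu * (T i * T j + f * H i j) - \sum_k H i k * H k j.
Proof.
have /(congr1 (d i)) := hess_grad j; rewrite dsum.
under eq_bigr do rewrite dM.
rewrite big_split /= dM dM dmu mul0r add0r => E.
apply: (addrI (\sum_k H i k * H k j)).
transitivity (mu * T i * T j + mu * f * H i j); last by ring.
rewrite -E /along; congr (_ + _); apply: eq_bigr => k _.
by rewrite [d k (d i _)]dC.
Qed.

(* [f ^+ 2] times the Hessian of the local branches of [log f]. *)
Definition log_hess : 'M[A]_n := \matrix_(i, j) (f * H i j - T i * T j).

(** The Riccati equation [D U = - U ^ 2] without denominators, where [log_hess] is [f ^ 2 * U] and
    [along] is [f * D]; the term with [mu] comes from differentiating the factor [f ^ 2]. *)
Let along_log_hess :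
  f *: map_mx along log_hess = (mu * f ^+ 2 *+ 2) *: log_hess - log_hess ^+ 2.
Proof.
apply/matrixP => i j.
have E2 : (log_hess ^+ 2) i j =
    f ^+ 2 * (\sum_k H i k * H k j) - mu * f ^+ 2 * (T i * T j).
  rewrite expr2 mxE.
  (* Three of the four terms of the square contract with the gradient; [hess_grad] and [eikonal]
     make them multiples of [T i * T j]. *)
  transitivity (f ^+ 2 * (\sum_k H i k * H k j) - f * T j * (\sum_k T k * H k i)
     - f * T i * (\sum_k T k * H k j) + T i * T j * (\sum_k T k * T k)).
    rewrite !mulr_sumr -!sumrB -big_split; apply: eq_bigr => k _ /=.
    rewrite !mxE [H i k]dC; ring.
  rewrite !hess_grad eikonal; ring.
rewrite [RHS]mxE [X in _ + X]mxE E2 !mxE alongD alongN !alongM.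
rewrite along_hess -[along f]/(\sum_k _) eikonal.
rewrite -[along (T i)]/(\sum_k _) -[along (T j)]/(\sum_k _) !hess_grad; ring.
Qed.

Let along_mulmx (X Y : 'M[A]_n) :
  map_mx along (X *m Y) = map_mx along X *m Y + X *m map_mx along Y.
Proof.
apply/matrixP => i j; rewrite !mxE (big_morph _ alongD along0) -big_split.
by apply: eq_bigr => k _; rewrite alongM !mxE.
Qed.

(** Induction by the Leibniz rule: by [along_log_hess] every term that arises is a scalar multiple
    of a power of [log_hess], so the order of factors is harmless. *)
Let along_log_hess_exp k :
  f *: map_mx along (log_hess ^+ k.+1) =
  (mu * f ^+ 2 *+ (k.+1).*2) *: log_hess ^+ k.+1 - log_hess ^+ k.+2 *+ k.+1.
Proof.
elim: k => [|k IH]; first by rewrite expr1 along_log_hess.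
rewrite [in LHS]exprS along_mulmx scalerDr scalemxAl scalemxAr along_log_hess IH.
have e1 : log_hess *m log_hess ^+ k.+1 = log_hess ^+ k.+2 by rewrite [RHS]exprS.
have e2 : log_hess ^+ 2 *m log_hess ^+ k.+1 = log_hess ^+ k.+3.
  by rewrite -[LHS]/(_ * _) -exprD.
have e3 : log_hess *m (log_hess ^+ k.+2 *+ k.+1) = log_hess ^+ k.+3 *+ k.+1.
  by rewrite -[LHS]/(_ * _) mulrnAr -exprS.
rewrite mulmxBl mulmxBr -scalemxAl -scalemxAr e1 e2 e3.
rewrite addrACA -scalerDl -opprD -mulrS.
by congr (_ *: _ - _); rewrite -mulrnDr doubleS.
Qed.

Lemma mxtrace_log_hess : \tr log_hess = (lam - mu) * f ^+ 2.
Proof.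
transitivity (f * (\sum_i H i i) - \sum_i T i * T i).
  by rewrite mulr_sumr -sumrB; apply: eq_bigr => i _; rewrite mxE.
rewrite laplace eikonal; ring.
Qed.

Hypothesis dlam : forall i, d i lam = 0.

(** Traces turn [along_log_hess_exp] into a recursion for the trace of the next power, in which a
    zero trace is followed by a zero trace. *)
Lemma mxtrace_log_hess_exp k : \tr (log_hess ^+ k.+2) = 0.
Proof.
have tr_along (X : 'M[A]_n) : \tr (map_mx along X) = along (\tr X).
  by rewrite /mxtrace (big_morph _ alongD along0); apply: eq_bigr => i _; rewrite mxE.
have rec l : \tr (log_hess ^+ l.+2) *+ l.+1 =
    (mu * f ^+ 2 *+ (l.+1).*2) * \tr (log_hess ^+ l.+1)
    - f * along (\tr (log_hess ^+ l.+1)).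
  have /(congr1 mxtrace) := along_log_hess_exp l.
  rewrite mxtraceZ tr_along raddfB /= mxtraceZ raddfMn /= => ->.
  by rewrite opprB addrC subrK.
(* The recursion starts because the trace of [log_hess] is a constant times [f ^+ 2], for which the
   two terms of [rec] cancel. *)
apply: (torsion_free (k := k)); rewrite rec; elim: k => [|k IH].
  rewrite expr1 mxtrace_log_hess alongM expr2 alongM -[along f]/(\sum_k _) eikonal.
  have -> : along (lam - mu) = 0.
    by rewrite /along big1 // => i _; rewrite dD dN dlam dmu subrr mulr0.
  rewrite mulr2n; ring.
by rewrite (torsion_free (etrans (rec k) IH)) along0 !mulr0 subrr.
Qed.

End Eikonal.

(** * Periodic functions: compactness and the maximum principle *)

Section Subharmonic.
Variables (R : realType) (n : nat) (G : lattice R n).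
Local Notation V := 'rV[R]_n.

Definition lattice_periodic (T : Type) (f : V -> T) :=
  forall k, lattice_set G k -> forall x, f (x + k) = f x.

(** Removing the integer parts of the coordinates in the basis [B] leaves coefficients in [0, 1), so
    the reduced point lies in a cube whose size [M] is the sum of all absolute entries of [B]. *)
Lemma compact_fundamental :
  exists K : set V, compact K /\ forall x, exists2 k, lattice_set G k & K (x + k).
Proof.
have [B Bu GE] := latticeP G.
pose M := \sum_i \sum_j `|B i j|.
exists [set x : V | forall i, x ord0 i \in `[(- M), M]]; split.
  apply: (@rV_compact _ _ (fun _ => [set` `[(- M), M]])) => _.
  exact: segment_compact.
move=> x; pose y := x *m invmx B.
pose z : 'rV[int]_n := \row_i - Num.floor (y 0 i).
exists (map_mx intr z *m B); first by rewrite GE; exists z.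
have -> : x + map_mx intr z *m B = (y + map_mx intr z) *m B.
  by rewrite mulmxDl mulmxKV.
move=> j; rewrite in_itv /= -ler_norml mxE (le_trans (ler_norm_sum _ _ _)) //.
apply: ler_sum => i _; rewrite (bigD1 j) //= ler_wpDr ?sumr_ge0 // normrM.
rewrite ler_piMl // !mxE rmorphN /=.
have /andP[] := floor_itv (y 0 i); rewrite rmorphD /= !mxE => lo hi.
rewrite ger0_norm; lra.
Qed.

Lemma periodic_max (w : V -> R) : continuous w -> lattice_periodic w ->
  exists p, forall x, w x <= w p.
Proof.
move=> cw pw; have [K [cK HK]] := compact_fundamental.
(* A lattice translate of the origin shows that the compact set is nonempty. *)
have [k0 _ Kk0] := HK 0.
have [||p _ Hp] := @EVT_max_rV R n w K _ cK; first by exists (0 + k0).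
  exact: continuous_subspaceT.
exists p => x; have [k Gk Kx] := HK x.
by rewrite -(pw k Gk) Hp // inE.
Qed.

Definition laplace (w : V -> R) x := \sum_i partial i (partial i w) x.

Lemma laplace_continuous w : smooth_real w -> continuous (laplace w).
Proof.
move=> sw; have -> : laplace w = \sum_i partial i (partial i w).
  by apply/funext => x; rewrite fct_sumE.
apply: smooth_real_continuous.
elim/big_ind: _ => [|f g|i _]; first exact: (smooth_real_cst 0).
  exact: smooth_realD.
by do 2! apply: smooth_real_partial.
Qed.

(** The witness is the sum of the translates of [w] by the vectors of [s]; the Laplacian commutes
    with translations. *)
Lemma sum_translates (w : V -> R) (s : seq V) : smooth_real w -> lattice_periodic w ->
  exists W, [/\ smooth_real W, lattice_periodic W &
    forall x, laplace W x = \sum_(v <- s) laplace w (x + v)].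
Proof.
move=> sw pw; elim: s => [|v s [W [sW pW EW]]].
  exists 0; split => [||x]; first exact: (smooth_real_cst 0).
    by [].
  rewrite big_nil; apply: big1 => i _.
  have pc c : partial i (cst c : V -> R) = cst 0.
    by apply/funext => y; rewrite /partial derive_cst.
  by rewrite (pc 0 : partial i (0 : V -> R) = cst 0) pc.
have swv := smooth_real_translate v sw.
exists ((fun x => w (x + v)) + W); split => [|k Gk x|x].
- exact: smooth_realD.
- rewrite -[LHS]/(w (x + k + v) + W (x + k)) addrAC pw // pW //.
rewrite big_cons -EW -big_split; apply: eq_bigr => i _ /=.
rewrite partialD // partialD; [|exact: smooth_real_partial..].
by rewrite !partial_translate.
Qed.

Lemma laplace_max (w : V -> R) p : smooth_real w -> (forall x, w x <= w p) ->
  (forall i, partial i w p = 0) /\ laplace w p <= 0.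
Proof.
move=> sw Hp.
have H i := line_max2 (x := p) (v := delta_mx 0 i)
  (fun s => @smooth_real_derivable _ _ w i _ sw)
  (fun s => @smooth_real_derivable _ _ _ i _ (smooth_real_partial i sw))
  (fun s => Hp _).
by split=> [i|]; [case: (H i)|apply: sumr_le0 => i _; case: (H i)].
Qed.

(* If the Laplacian were positive somewhere, then by compactness the sum of
   finitely many translates would have positive Laplacian everywhere, also at
   its maximum. *)
Lemma subharmonic_periodic (w : V -> R) : smooth_real w -> lattice_periodic w ->
  (forall x, 0 <= laplace w x) -> forall x, laplace w x = 0.
Proof.
move=> sw pw lw0 p; apply/eqP; rewrite eq_le lw0 andbT leNgt; apply/negP => lp.
have [K [cK HK]] := compact_fundamental.
pose U (v : V) := [set x : V | 0 < laplace w (x + v)].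
have Uop v : [set: V] v -> open (U v).
  move=> _; have cwv : continuous (fun x : V => laplace w (x + v)).
    move=> x; apply: continuous_comp; last exact: laplace_continuous.
    by apply: continuousD; [exact: cvg_id|exact: cst_continuous].
  rewrite (_ : U v = (fun x : V => laplace w (x + v)) @^-1` [set y | 0 < y]) //.
  by apply: open_comp => [x _|]; [exact: cwv|exact: open_gt].
have KU : K `<=` cover [set: V] U.
  (* Translation by [p - x] takes [x] to the point [p], where the Laplacian is positive. *)
  move=> x _; exists (p - x); first by [].
  have xp : x + (p - x) = p by rewrite addrC subrK.
  by rewrite /U /= xp.
rewrite compact_cover in cK; have [D _ KD] := cK _ _ _ Uop KU.
have [W [sW pW EW]] := sum_translates (enum_fset D) sw pw.
have [q Hq] := periodic_max (smooth_real_continuous sW) pW.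
(* A lattice vector moves the maximum into [K], where some translate in [D] has positive
   Laplacian. *)
have [k Gk Kq] := HK q.
have Hq' x : W x <= W (q + k) by rewrite pW.
have [_] := laplace_max sW Hq'; rewrite leNgt => /negP; apply.
have [v vD Uv] := KD _ Kq; rewrite EW (big_rem v) //=.
by apply: ltr_wpDr; [apply: sumr_ge0 => u _; exact: lw0|exact: Uv].
Qed.

End Subharmonic.

(** * The ring of smooth complex functions, its derivations and its conjugation *)

Section SmoothComplex.
Variables (R : realType) (n : nat).
Local Notation V := 'rV[R]_n.
Local Notation C := R[i].
Implicit Types (f g : V -> C).

Local Notation re f := (fun x => complex.Re (f x)).
Local Notation im f := (fun x => complex.Im (f x)).

Lemma ReD (z z' : C) : complex.Re (z + z') = complex.Re z + complex.Re z'.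
Proof. by case: z z' => ? ? []. Qed.

Lemma ImD (z z' : C) : complex.Im (z + z') = complex.Im z + complex.Im z'.
Proof. by case: z z' => ? ? []. Qed.

Lemma ReM (z z' : C) : complex.Re (z * z') =
  complex.Re z * complex.Re z' - complex.Im z * complex.Im z'.
Proof. by case: z z' => ? ? []. Qed.

Lemma ImM (z z' : C) : complex.Im (z * z') =
  complex.Re z * complex.Im z' + complex.Im z * complex.Re z'.
Proof. by case: z z' => ? ? []. Qed.

Lemma reD f g : re (f + g) = re f + re g.
Proof. by apply/funext => x; exact: ReD. Qed.

Lemma imD f g : im (f + g) = im f + im g.
Proof. by apply/funext => x; exact: ImD. Qed.

Lemma reM f g : re (f * g) = re f * re g + - (im f * im g).
Proof. by apply/funext => x; exact: ReM. Qed.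

Lemma imM f g : im (f * g) = re f * im g + im f * re g.
Proof. by apply/funext => x; exact: ImM. Qed.

Lemma smoothC_cst (c : C) : smoothC (cst c : V -> C).
Proof. by split; exact: smooth_real_cst. Qed.

Lemma smoothCD f g : smoothC f -> smoothC g -> smoothC (f + g).
Proof.
by move=> [? ?] [? ?]; split; rewrite ?reD ?imD; exact: smooth_realD.
Qed.

Lemma smoothCM f g : smoothC f -> smoothC g -> smoothC (f * g).
Proof.
move=> [? ?] [? ?]; split.
  by rewrite reM; apply: smooth_realD; [|apply: smooth_realN]; exact: smooth_realM.
by rewrite imM; apply: smooth_realD; exact: smooth_realM.
Qed.

Lemma smoothC_partialC i f : smoothC f -> smoothC (partialC i f).
Proof. by move=> [? ?]; split; exact: smooth_real_partial. Qed.

Definition smooth_pred : {pred V -> C} := fun f => `[< smoothC f >].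

Lemma smooth_pred_subring : subring_closed smooth_pred.
Proof.
split=> [|f g /asboolP sf /asboolP sg|f g /asboolP sf /asboolP sg].
- by apply/asboolP; exact: (smoothC_cst 1).
- have -> : f - g = f + cst (-1) * g.
    by congr (_ + _); apply/funext => x; rewrite [RHS]mulN1r.
  by apply/asboolP; exact: smoothCD sf (smoothCM (smoothC_cst _) sg).
- by apply/asboolP; exact: smoothCM.
Qed.

(** Bundling smoothness yields a commutative ring, to which both the abstract eikonal argument and
    [ring] apply. *)
Record smooth_fun := SmoothFun {
  smooth_fun_val :> V -> C; smooth_fun_subproof : smooth_fun_val \in smooth_pred }.
HB.instance Definition _ := [isSub for smooth_fun_val].
HB.instance Definition _ := [Choice of smooth_fun by <:].
HB.instance Definition _ := GRing.SubChoice_isSubComPzRing.Build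
  (V -> C) smooth_pred smooth_fun smooth_pred_subring.

Implicit Types (F H : smooth_fun) (x : V).

Lemma smooth_funP F : smoothC F.
Proof. exact/asboolP/smooth_fun_subproof. Qed.

Definition mk_smooth f (sf : smoothC f) : smooth_fun := SmoothFun (asboolT sf).

Lemma smooth_fun_ext F H : (forall x, F x = H x) -> F = H.
Proof. by move=> FH; apply: val_inj; exact: funext FH. Qed.

Lemma smooth_funD F H x : (F + H) x = F x + H x. Proof. by []. Qed.
Lemma smooth_funM F H x : (F * H) x = F x * H x. Proof. by []. Qed.

Lemma smooth_fun_sum (I : Type) (r : seq I) (E : I -> smooth_fun) x :
  (\sum_(i <- r) E i) x = \sum_(i <- r) E i x.
Proof. exact: (big_morph (fun F : smooth_fun => F x) (fun _ _ => erefl) erefl). Qed.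

Lemma smooth_funMn F k x : (F *+ k) x = F x *+ k.
Proof. by elim: k => // k IH; rewrite !mulrS smooth_funD IH. Qed.

Definition smooth_cst (c : C) : smooth_fun := mk_smooth (smoothC_cst c).

Definition dpartial i F : smooth_fun := mk_smooth (smoothC_partialC i (smooth_funP F)).

Lemma dpartialD i F H : dpartial i (F + H) = dpartial i F + dpartial i H.
Proof.
have [rF iF] := smooth_funP F; have [rH iH] := smooth_funP H.
apply: smooth_fun_ext => x; rewrite smooth_funD /= /partialC.
have -> : re (F + H) = re F + re H by exact: reD.
have -> : im (F + H) = im F + im H by exact: imD.
by rewrite !partialD.
Qed.

Lemma dpartialM i F H :
  dpartial i (F * H) = dpartial i F * H + F * dpartial i H.
Proof.
have [rF iF] := smooth_funP F; have [rH iH] := smooth_funP H.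
apply: smooth_fun_ext => x; rewrite smooth_funD !smooth_funM /= /partialC.
have -> : re (F * H) = re F * re H + - (im F * im H) by exact: reM.
have -> : im (F * H) = re F * im H + im F * re H by exact: imM.
have sM := smooth_realM.
rewrite partialD; [|exact: sM|apply: smooth_realN; exact: sM].
rewrite partialD; [|exact: sM|exact: sM].
rewrite partialN; last exact: sM.
rewrite !partialM //; apply/eqP.
rewrite eq_complex !ReD !ImD !ReM !ImM /=.
set a := partial i (re F); set b := partial i (im F).
set c := partial i (re H); set d := partial i (im H).
rewrite -[(_ - _) x]/((a x * complex.Re (H x) + complex.Re (F x) * c x)
  - (b x * complex.Im (H x) + complex.Im (F x) * d x)).
rewrite -[(_ + _) x]/((a x * complex.Im (H x) + complex.Re (F x) * d x)
  + (b x * complex.Re (H x) + complex.Im (F x) * c x)).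
move: (a x) (b x) (c x) (d x) (F x) (H x) => {}a {}b {}c {}d [p q] [r s] /=.
by apply/andP; split; apply/eqP; ring.
Qed.

Lemma dpartial_commute i j F : dpartial i (dpartial j F) = dpartial j (dpartial i F).
Proof.
have [rF iF] := smooth_funP F; apply: smooth_fun_ext => x.
exact: (f_equal2 (@Complex R) (congr1 (@^~ x) (partial_schwarz i j rF))
                              (congr1 (@^~ x) (partial_schwarz i j iF))).
Qed.

Lemma dpartial_cst i c : dpartial i (smooth_cst c) = 0.
Proof.
apply: smooth_fun_ext => x; have pc (a : R) : partial i (cst a) x = 0.
  exact: derive_cst.
exact: (f_equal2 (@Complex R) (pc _) (pc _)).
Qed.

Lemma smoothC_conj f : smoothC f -> smoothC (fun x => (f x)^*%C).
Proof.
case=> rf jf; split.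
  by have -> : re (fun x => (f x)^*%C) = re f by apply/funext => x; case: (f x).
have -> : im (fun x => (f x)^*%C) = - im f.
  by apply/funext => x; rewrite -[RHS]/(- complex.Im (f x)); case: (f x).
exact: smooth_realN.
Qed.

Definition smooth_conj F : smooth_fun := mk_smooth (smoothC_conj (smooth_funP F)).

Lemma dpartial_conj i F : dpartial i (smooth_conj F) = smooth_conj (dpartial i F).
Proof.
have [rF iF] := smooth_funP F; apply: smooth_fun_ext => x.
have reJ : re (fun x => (F x)^*%C) = re F by apply/funext => y; case: (F y).
have imJ : im (fun x => (F x)^*%C) = - im F.
  by apply/funext => y; rewrite -[RHS]/(- complex.Im (F y)); case: (F y).
exact: (f_equal2 (@Complex R) (congr1 (fun h => partial i h x) reJ)
  (congr1 (@^~ x) (etrans (congr1 (partial i) imJ) (partialN i iF)))).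
Qed.

Lemma dpartial0_cst F : (forall i, dpartial i F = 0) -> forall x y, F x = F y.
Proof.
move=> dF x y; have [rF iF] := smooth_funP F.
have dF0 i z : partial i (re F) z = 0 /\ partial i (im F) z = 0.
  have /(congr1 (fun H : smooth_fun => H z)) /eqP := dF i.
  by rewrite eq_complex /= => /andP[/eqP-> /eqP->].
apply/eqP; rewrite eq_complex; apply/andP; split; apply/eqP.
  by apply: (partial0_cst rF) => i z; case: (dF0 i z).
by apply: (partial0_cst iF) => i z; case: (dF0 i z).
Qed.

Lemma smooth_fun_torsion_free k F : F *+ k.+1 = 0 -> F = 0.
Proof.
move=> F0; apply: smooth_fun_ext => x; apply/eqP.
have /(congr1 (fun H : smooth_fun => H x)) /eqP := F0.
by rewrite smooth_funMn mulrn_eq0.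
Qed.

End SmoothComplex.

(** * Plane waves and their derivatives *)

Section Waves.
Variables (R : realType) (n : nat).
Local Notation V := 'rV[R]_n.
Implicit Types (t x : V).

Lemma is_derive_from_line (f : V -> R) x v d :
  is_derive (0 : R) 1 (fun s : R => f (x + s *: v)) d -> is_derive x v f d.
Proof.
have E : (fun h : R => h^-1 *: (((fun s : R => f (x + s *: v)) \o shift 0) (h *: (1 : R))
                       - f (x + 0 *: v))) =
    (fun h : R => h^-1 *: ((f \o shift x) (h *: v) - f x)).
  apply/funext => h /=; rewrite scale0r addr0.
  by rewrite [h *: 1]mulr1 addr0 (addrC x).
by case=> df dE; split; [move: df|move: dE]; rewrite /derivable /derive [X in X @ _]E.
Qed.

Lemma dot_continuous t : continuous (dot t).
Proof.
have -> : dot t = \sum_i (fun x => t 0 i * x 0 i).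
  by apply/funext => x; rewrite fct_sumE.
elim/big_ind: _ => [|f g cf cg x|i _ x]; first exact: cst_continuous.
  by apply: continuousD; [exact: cf|exact: cg].
by apply: continuousM; [exact: cst_continuous|exact: coord_continuous].
Qed.

Lemma dotDr (K : pzRingType) (u v w : 'rV[K]_n) : dot u (v + w) = dot u v + dot u w.
Proof. by rewrite /dot -big_split; apply: eq_bigr => i _; rewrite mxE mulrDr. Qed.

Lemma dotC (K : comPzRingType) (u v : 'rV[K]_n) : dot u v = dot v u.
Proof. by apply: eq_bigr => i _; rewrite mulrC. Qed.

Lemma dot_delta t (s : R) i : dot t (s *: delta_mx 0 i) = s * t 0 i.
Proof.
rewrite /dot (bigD1 i) //= big1 => [|j ji]; rewrite !mxE ?eqxx.
  by rewrite addr0 mulr1 mulrC.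
by rewrite (negPf ji) !mulr0.
Qed.

(** Two free coefficients make this class stable under partial derivatives, so that
    [smooth_real_coind] applies. *)
Definition trig t (a b : R) x := a * cos (dot t x) + b * sin (dot t x).

Lemma is_derive_trig t a b x i :
  is_derive x (delta_mx 0 i) (trig t a b) (trig t (t 0 i * b) (- (t 0 i * a)) x).
Proof.
apply: is_derive_from_line.
pose l : R -> R := cst (dot t x) + t 0 i *: id.
have -> : (fun s : R => trig t a b (x + s *: delta_mx 0 i)) =
          a *: (cos \o l) + b *: (sin \o l).
  apply/funext => s; rewrite /trig dotDr dot_delta mulrC (mulrC s).
  by rewrite (mulrC _ a).
have dl : is_derive (0 : R) 1 l (0 + t 0 i *: 1).
  exact: is_deriveD (is_derive_cst _ _ _) (is_deriveZ _ (is_derive_id _ _)).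
have l0 : l 0 = dot t x by rewrite /l -[LHS]/(_ + t 0 i * 0) mulr0 addr0.
have dc := is_derive1_comp (is_derive_cos (l 0)) dl.
have ds := is_derive1_comp (is_derive_sin (l 0)) dl.
have -> : trig t (t 0 i * b) (- (t 0 i * a)) x =
    a *: (- sin (l 0) * (0 + t 0 i *: 1)) + b *: (cos (l 0) * (0 + t 0 i *: 1)).
  rewrite l0 /trig -[RHS]/(a * (- sin (dot t x) * (0 + t 0 i * 1)) +
                           b * (cos (dot t x) * (0 + t 0 i * 1))); ring.
exact: is_deriveD (is_deriveZ a dc) (is_deriveZ b ds).
Qed.

Lemma smooth_trig t a b : smooth_real (trig t a b).
Proof.
apply: (@smooth_real_coind _ _ [set trig t p.1 p.2 | p in [set: R * R]]).
- move=> _ [[c d] _ <-]; split=> [x|i x]; last by case: (is_derive_trig t c d x i).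
  rewrite [trig _ _ _](_ : _ = cst c * (cos \o dot t) + cst d * (sin \o dot t)) //.
  apply: continuousD; apply: continuousM; try exact: cst_continuous.
    by apply: continuous_comp; [exact: dot_continuous|exact: continuous_cos].
  by apply: continuous_comp; [exact: dot_continuous|exact: continuous_sin].
- move=> _ i [[c d] _ <-]; exists (t 0 i * d, - (t 0 i * c)) => //=.
  by apply/funext => x; rewrite /partial; case: (is_derive_trig t c d x i).
- by exists (a, b).
Qed.

Lemma partial_trig t a b i :
  partial i (trig t a b) = trig t (t 0 i * b) (- (t 0 i * a)).
Proof. by apply/funext => x; rewrite /partial; case: (is_derive_trig t a b x i). Qed.

Lemma smoothC_wave t : smoothC (fun x => Complex (cos (dot t x)) (sin (dot t x))).
Proof.
split.
  have -> : (fun x => cos (dot t x)) = trig t 1 0.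
    by apply/funext => x; rewrite /trig mul1r mul0r addr0.
  exact: smooth_trig.
have -> : (fun x => sin (dot t x)) = trig t 0 1.
  by apply/funext => x; rewrite /trig mul1r mul0r add0r.
exact: smooth_trig.
Qed.

(** The frequency [t] corresponds to [2 * pi] times a vector [k'] of the dual lattice; this keeps
    [pi] out of the derivatives. *)
Definition wave t : smooth_fun R n := mk_smooth (smoothC_wave t).

Lemma dpartial_wave i t :
  dpartial i (wave t) = smooth_cst n (Complex 0 (t 0 i)) * wave t.
Proof.
have Ec : (fun x => cos (dot t x)) = trig t 1 0.
  by apply/funext => x; rewrite /trig mul1r mul0r addr0.
have Es : (fun x => sin (dot t x)) = trig t 0 1.
  by apply/funext => x; rewrite /trig mul1r mul0r add0r.
apply: smooth_fun_ext => x; rewrite smooth_funM.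
apply: etrans (f_equal2 (@Complex R)
  (congr1 (@^~ x) (etrans (congr1 (partial i) Ec) (partial_trig t 1 0 i)))
  (congr1 (@^~ x) (etrans (congr1 (partial i) Es) (partial_trig t 0 1 i)))) _.
apply/eqP; rewrite eq_complex /= /trig; apply/andP; split; apply/eqP; ring.
Qed.

Lemma wave_conj t x : smooth_conj (wave t) x * wave t x = 1.
Proof.
apply/eqP; rewrite eq_complex /=; apply/andP; split; apply/eqP; last by ring.
by rewrite mulNr opprK -!expr2 cos2Dsin2.
Qed.

End Waves.

(** * Equality of the two eigenvalues, and the Bochner argument *)

Section Rigidity.
Variables (R : realType) (n : nat).
Local Notation V := 'rV[R]_n.
Local Notation C := R[i].
Local Notation D := (@dpartial R n).
Local Notation K := (@smooth_cst R n).
Implicit Types (F H : smooth_fun R n).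

(** Evaluated at [p], the logarithmic Hessian is a complex matrix whose powers from the second on
    have trace zero; its own trace [(lam - mu) * F p ^+ 2] is then zero too. *)
Lemma eikonal_eigenvalue F (lam mu : C) p : F p != 0 ->
  \sum_i D i (D i F) = K lam * F -> \sum_i D i F * D i F = K mu * F ^+ 2 ->
  lam = mu.
Proof.
move=> Fp lapF eikF.
have tr0 := mxtrace_log_hess_exp (@dpartialD R n) (@dpartialM R n)
  (@dpartial_commute R n) (@smooth_fun_torsion_free R n)
  (fun i => dpartial_cst i mu) eikF lapF (fun i => dpartial_cst i lam).
have tr1 := mxtrace_log_hess eikF lapF.
set L := log_hess _ _ in tr0 tr1.
pose ev H : C := H p.
have trev (X : 'M[smooth_fun R n]_n) : \tr (map_mx ev X) = ev (\tr X).
  by rewrite /ev smooth_fun_sum; apply: eq_bigr => i _; rewrite mxE.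
have evM (X Y : 'M[smooth_fun R n]_n) : map_mx ev (X *m Y) = map_mx ev X *m map_mx ev Y.
  apply/matrixP => i j; rewrite !mxE /ev smooth_fun_sum.
  by apply: eq_bigr => k _; rewrite !mxE.
have evX k : map_mx ev (L ^+ k.+1) = map_mx ev L ^+ k.+1.
  elim: k => [|k IH]; first by rewrite !expr1.
  rewrite exprS (evM L (L ^+ k.+1)) IH [RHS]exprS //.
have : \tr (map_mx ev L) = 0.
  by apply: mxtrace_powers_eq0 => k; rewrite -evX trev tr0.
rewrite trev tr1 => T0; have {}T0 : (lam - mu) * (F p * F p) = 0 := T0.
by apply: subr0_eq; apply: (mulIf (mulf_neq0 Fp Fp)); rewrite T0 mul0r.
Qed.

(** Here [s = 1] describes real and [s = -1] imaginary numbers; the squared modulus of [y i] is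
    [s * (y i * y i)], so a sum of nonnegative terms vanishes. *)
Lemma sumr_sqr_conj_eq0 (I : finType) (y : I -> C) (s : C) :
  (forall i, (y i)^*%C = s * y i) -> \sum_i y i * y i = 0 -> forall i, y i = 0.
Proof.
move=> yJ y0 i.
have S0 : \sum_j y j * (y j)^*%C = 0.
  rewrite (eq_bigr (fun j => s * (y j * y j))) -?mulr_sumr ?y0 ?mulr0 // => j _.
  by rewrite yJ mulrCA.
have E : y i * (y i)^*%C = 0.
  by apply: (psumr_eq0P _ S0) => // j _; exact: mulcJ_ge0.
by move/eqP: E; rewrite mulf_eq0 conjc_eq0 orbb => /eqP.
Qed.

Lemma smooth_conjM F H : smooth_conj (F * H) = smooth_conj F * smooth_conj H.
Proof. by apply: smooth_fun_ext => x; rewrite smooth_funM /= rmorphM. Qed.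

Lemma smooth_conjK F : smooth_conj (smooth_conj F) = F.
Proof. by apply: smooth_fun_ext => x; rewrite /= conjcK. Qed.

Lemma smooth_conj_cst c : smooth_conj (K c) = K c^*%C.
Proof. exact: smooth_fun_ext. Qed.

Lemma smooth_conj_sum (E : 'I_n -> smooth_fun R n) :
  smooth_conj (\sum_i E i) = \sum_i smooth_conj (E i).
Proof.
apply: smooth_fun_ext => x; rewrite !smooth_fun_sum /= smooth_fun_sum rmorph_sum.
by [].
Qed.

Lemma dpartial0 i : D i 0 = 0.
Proof. by apply: (addrI (D i 0)); rewrite -dpartialD !addr0. Qed.

Lemma dpartial_sum i (E : 'I_n -> smooth_fun R n) :
  D i (\sum_k E k) = \sum_k D i (E k).
Proof. exact: (big_morph _ (dpartialD i) (dpartial0 i)). Qed.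

Lemma dpartial0_smooth_cst F : (forall i, D i F = 0) -> F = K (F 0).
Proof. by move=> dF; apply: smooth_fun_ext => x; exact: dpartial0_cst. Qed.

Section Bochner.
Variables (F : smooth_fun R n) (lam : C).
Local Notation g := (smooth_conj F).
Local Notation W := (F * smooth_conj F).
Hypothesis lapF : \sum_i D i (D i F) = K lam * F.
Hypothesis eikF : \sum_i D i F * D i F = K lam * F ^+ 2.
Hypothesis lamJ : lam^*%C = lam.
Hypothesis lapW : \sum_i D i F * D i g = - (K lam * W).
Variable p : V.
Hypothesis Fp : F p != 0.

Let KlamJ : K lam = smooth_conj (K lam).
Proof. by rewrite smooth_conj_cst lamJ. Qed.

Lemma laplace_conj : \sum_i D i (D i g) = K lam * g.
Proof.
rewrite KlamJ -smooth_conjM -lapF smooth_conj_sum.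
by apply: eq_bigr => i _; rewrite !dpartial_conj.
Qed.

Let eikg : \sum_i D i g * D i g = K lam * g ^+ 2.
Proof.
rewrite KlamJ expr2 -!smooth_conjM -expr2 -eikF smooth_conj_sum.
by apply: eq_bigr => i _; rewrite smooth_conjM dpartial_conj.
Qed.

(** The square of the gradient of [W] expands to [lam - 2 * lam + lam] times [W ^+ 2], and that
    gradient is real. *)
Let dW i : D i W = 0.
Proof.
have sq : \sum_i D i W * D i W = 0.
  transitivity (g ^+ 2 * (\sum_i D i F * D i F) +
     (F * g * (\sum_i D i F * D i g)) *+ 2 + F ^+ 2 * (\sum_i D i g * D i g)).
    rewrite !mulr_sumr -sumrMnl -!big_split; apply: eq_bigr => k _ /=.
    by rewrite dpartialM; ring.
  by rewrite eikF eikg lapW; ring.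
apply: smooth_fun_ext => x.
apply: (@sumr_sqr_conj_eq0 _ (fun i => D i W x) 1) => [j|].
  rewrite mul1r; have : smooth_conj (D j W) = D j W.
    by rewrite -dpartial_conj smooth_conjM smooth_conjK mulrC.
  by move=> /(congr1 (fun H : smooth_fun R n => H x)).
by have /(congr1 (fun H : smooth_fun R n => H x)) := sq; rewrite smooth_fun_sum.
Qed.

Let Wx x : W x = W p. Proof. exact: dpartial0_cst. Qed.

Let W0 x : W x != 0.
Proof. by rewrite Wx smooth_funM mulf_neq0 //= conjc_eq0. Qed.

Let mulIW H H' : W * H = W * H' -> H = H'.
Proof.
move=> E; apply: smooth_fun_ext => x; apply: (mulfI (W0 x)).
by rewrite -!smooth_funM E.
Qed.

(** Up to the constant factor [W] this is the logarithmic gradient of [F]; it will turn out closed,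
    divergence-free, of constant square and imaginary. *)
Local Notation u i := (D i F * g).

Let uE i : u i = - (F * D i g).
Proof. by apply/eqP; rewrite -addr_eq0 -dpartialM dW. Qed.

Let uJ i x : (u i x)^*%C = - u i x.
Proof.
have : smooth_conj (u i) = - u i.
  by rewrite smooth_conjM smooth_conjK -dpartial_conj uE opprK mulrC.
by move=> /(congr1 (fun H : smooth_fun R n => H x)).
Qed.

(** Only [D i F * D k g] has to be symmetric; multiplied by [W] it becomes [- (u i * u k)]. *)
Let du_sym i k : D k (u i) = D i (u k).
Proof.
rewrite !dpartialM dpartial_commute; congr (_ + _); apply: mulIW.
transitivity (u i * (F * D k g)); first by ring.
transitivity (u k * (F * D i g)); last by ring.
have -> : F * D k g = - u k by rewrite uE opprK.
have -> : F * D i g = - u i by rewrite uE opprK.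
by ring.
Qed.

Let div_u : \sum_i D i (u i) = 0.
Proof.
under eq_bigr do rewrite dpartialM.
by rewrite big_split /= -mulr_suml lapF lapW; ring.
Qed.

Let norm_u : \sum_i u i * u i = K lam * W ^+ 2.
Proof.
transitivity (g ^+ 2 * (\sum_i D i F * D i F)); last by rewrite eikF; ring.
by rewrite mulr_sumr; apply: eq_bigr => i _; ring.
Qed.

(** Bochner: the sum of the squares of all [D j (u i)] is half the Laplacian of the constant
    [norm_u] minus the pairing of [u] with the gradient of its divergence, hence zero; the entries
    are imaginary, so each vanishes. *)
Let du i k : D k (u i) = 0.
Proof.
have dnorm j : \sum_i u i * D j (u i) = 0.
  apply: (smooth_fun_torsion_free (k := 1)).
  have /(congr1 (D j)) := norm_u; rewrite dpartial_sum.
  under eq_bigr do rewrite dpartialM.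
  rewrite dpartialM dpartial_cst expr2 dpartialM dW mulr0 !mul0r addr0 mulr0 add0r.
  move=> E; rewrite -[RHS]E mulr2n -big_split; apply: eq_bigr => l _ /=.
  by rewrite [X in _ = X + _]mulrC.
have sq : \sum_j \sum_i D j (u i) * D j (u i) = 0.
  transitivity (\sum_j D j (\sum_i u i * D j (u i)) -
                \sum_i u i * D i (\sum_j D j (u j))).
    transitivity (\sum_j \sum_i (D j (u i) * D j (u i) + u i * D j (D j (u i))) -
                  \sum_j \sum_i (u i * D j (D j (u i)))).
      by rewrite -sumrB; apply: eq_bigr => j _; rewrite -sumrB;
         apply: eq_bigr => l _; rewrite addrK.
    congr (_ - _).
      apply: eq_bigr => j _; rewrite dpartial_sum; apply: eq_bigr => l _.
      by rewrite [RHS]dpartialM.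
    (* Closedness and commuting derivatives turn [D j (D j (u l))] into [D l (D j (u j))], the
       gradient of the divergence. *)
    rewrite exchange_big; apply: eq_bigr => l _ /=.
    rewrite dpartial_sum mulr_sumr; apply: eq_bigr => j _.
    by rewrite du_sym dpartial_commute.
  rewrite big1 => [|j _]; last by rewrite dnorm dpartial0.
  by rewrite div_u sub0r big1 ?oppr0 // => j _; rewrite dpartial0 mulr0.
apply: smooth_fun_ext => x.
rewrite pair_big /= in sq.
apply: (@sumr_sqr_conj_eq0 _ (fun q : 'I_n * 'I_n => D q.1 (u q.2) x) (-1) _ _ (k, i)).
  move=> [j l] /=; rewrite mulN1r.
  have : smooth_conj (D j (u l)) = - D j (u l).
    rewrite -dpartial_conj (_ : smooth_conj (u l) = - u l).
      by apply/eqP; rewrite -addr_eq0 -dpartialD addrC subrr dpartial0.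
    by apply: smooth_fun_ext => y; exact: uJ.
  by move=> /(congr1 (fun H : smooth_fun R n => H x)).
by have /(congr1 (fun H : smooth_fun R n => H x)) := sq; rewrite smooth_fun_sum.
Qed.

(** The quotient of [u] by [W] is a constant imaginary vector, so [F] and [wave t] obey the same
    first-order equations and [F * smooth_conj (wave t)] is constant; its value is [c]. *)
Lemma unimodular_eigenfunction_wave :
  exists (t : V) (c : C), lam = - (Complex (dot t t) 0) /\ F = K c * wave t.
Proof.
(* The quotient is [D i F p / F p], and its real part vanishes by [uJ]. *)
pose t : V := \row_i complex.Im (u i p / W p).
have WpJ : (W p)^*%C = W p by rewrite smooth_funM rmorphM /= conjcK mulrC.
have tE i : u i p = Complex 0 (t 0 i) * W p.
  apply: (canRL (mulfVK (W0 p))); set q := u i p / W p.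
  rewrite mxE -/q.
  have : q^*%C = - q by rewrite rmorphM /= conjc_inv WpJ uJ mulNr.
  case: q => a b [/eqP]; rewrite -addr_eq0 -mulr2n mulrn_eq0 /= => /eqP ->.
  by [].
have dF i : D i F = K (Complex 0 (t 0 i)) * F.
  apply: mulIW; transitivity (u i * F); first by ring.
  rewrite (dpartial0_smooth_cst (du i)) (dpartial0_smooth_cst dW).
  have -> : u i 0 = Complex 0 (t 0 i) * W 0.
    by rewrite (Wx 0) -tE; exact: dpartial0_cst (du i) _ _.
  by apply: smooth_fun_ext => x; rewrite !smooth_funM /=; ring.
exists t, ((F * smooth_conj (wave t)) 0); split.
  have /(congr1 (fun H : smooth_fun R n => H p)) := eikF.
  rewrite smooth_fun_sum.
  rewrite (eq_bigr (fun i => - (Complex (t 0 i * t 0 i) 0) * (F p * F p))); last first.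
    move=> i _; rewrite smooth_funM dF smooth_funM /= mulrACA; congr (_ * _).
    by apply/eqP; rewrite eq_complex /=; apply/andP; split; apply/eqP; ring.
  rewrite -mulr_suml => E; apply/esym.
  have FF : F p * F p != 0 by rewrite mulf_neq0.
  apply: (mulIf FF); rewrite -[RHS]E; congr (_ * _).
  by rewrite sumrN; congr (- _); exact: (rmorph_sum (real_complex R)).
rewrite -dpartial0_smooth_cst => [|i].
  apply: smooth_fun_ext => x; rewrite !smooth_funM -mulrA.
  by rewrite wave_conj mulr1.
rewrite dpartialM dF dpartial_conj dpartial_wave smooth_conjM smooth_conj_cst.
have -> : (Complex 0 (t 0 i))^*%C = - Complex 0 (t 0 i).
  by apply/eqP; rewrite eq_complex /= oppr0 !eqxx.
have -> : K (- Complex 0 (t 0 i)) = - K (Complex 0 (t 0 i)) by exact: smooth_fun_ext.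
by ring.
Qed.

End Bochner.

End Rigidity.

(** * Sign of the eigenvalue and harmonicity of the squared modulus *)

Section PeriodicEigenfunctions.
Variables (R : realType) (n : nat) (G : lattice R n).
Local Notation V := 'rV[R]_n.
Local Notation C := R[i].
Local Notation D := (@dpartial R n).
Local Notation K := (@smooth_cst R n).

Lemma ger0_conjc (z : C) : 0 <= z -> z^*%C = z.
Proof. by move=> /ger0_Im; case: z => a b /= ->; rewrite oppr0. Qed.

Variables (F : smooth_fun R n) (lam : C) (p : V).
Hypothesis perF : lattice_periodic G F.
Hypothesis Fp : F p != 0.
Hypothesis lapF : \sum_i D i (D i F) = K lam * F.
Hypothesis eikF : \sum_i D i F * D i F = K lam * F ^+ 2.
Local Notation W := (F * smooth_conj F).
Local Notation w := (fun x => complex.Re (W x)).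

Let WE x : W x = F x * (F x)^*%C. Proof. by []. Qed.

Let perw : lattice_periodic G w.
Proof. by move=> k Gk x; rewrite !WE perF. Qed.

Let smooth_w : smooth_real w. Proof. by case: (smooth_funP W). Qed.

Let eikFx x : \sum_i D i F x * D i F x = lam * (F x * F x).
Proof.
have /(congr1 (fun H : smooth_fun R n => H x)) := eikF.
by rewrite smooth_fun_sum.
Qed.

Lemma laplace_Re (H : smooth_fun R n) x :
  laplace (fun y => complex.Re (H y)) x = complex.Re ((\sum_i D i (D i H)) x).
Proof. by rewrite smooth_fun_sum (big_morph (@complex.Re R) (@ReD R) erefl). Qed.

(* At a maximum of |F|^2 the numbers conj F * D i F are purely imaginary. *)
Let lam_le0 : 0 <= - lam.
Proof.
have [q maxq] := periodic_max (smooth_real_continuous smooth_w) perw.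
have [dw _] := laplace_max smooth_w maxq.
have Wge0 x : 0 <= W x by exact: mulcJ_ge0.
(* A zero at [q] would make the maximum of the squared modulus zero, against [Fp]. *)
have Fq : F q != 0.
  apply: contra_neq Fp => Fq; have := maxq p.
  rewrite (WE q) Fq mul0r /= => wp.
  have Wp0 : W p = 0.
    have := Wge0 p; rewrite lecE => /andP[/eqP i0 r0].
    by apply/eqP; rewrite eq_complex i0 eqxx andbT eq_le wp.
  by move/eqP: Wp0; rewrite WE mulf_eq0 conjc_eq0 orbb => /eqP.
pose y i := D i F q * (F q)^*%C.
have yJ i : (y i)^*%C = - y i.
  have E : D i W q = y i + (y i)^*%C.
    rewrite dpartialM dpartial_conj smooth_funD !smooth_funM /y rmorphM /= conjcK.
    by rewrite mulrC [X in _ + X]mulrC.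
  apply/eqP; rewrite -addr_eq0 addrC -E eq_complex; apply/andP; split.
    by apply/eqP; exact: dw.
  by rewrite E; case: (y i) => a b /=; rewrite subrr.
have N0 : 0 < (F q * (F q)^*%C) ^+ 2.
  by rewrite exprn_gt0 // lt0r mulcJ_ge0 mulf_neq0 // conjc_eq0.
(* For imaginary [y i] the squared modulus is [- y i ^+ 2], and the eikonal equation evaluates the
   sum of squares. *)
have E : \sum_i y i * (y i)^*%C = - lam * (F q * (F q)^*%C) ^+ 2.
  transitivity (- ((F q)^*%C ^+ 2 * \sum_i D i F q * D i F q)).
    rewrite mulr_sumr -sumrN; apply: eq_bigr => i _; rewrite yJ /y; ring.
  by rewrite eikFx; ring.
rewrite -(pmulr_lge0 _ N0) -E; apply: sumr_ge0 => i _; exact: mulcJ_ge0.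
Qed.

Let lamJ : lam^*%C = lam.
Proof. by apply: oppr_inj; rewrite -rmorphN /= ger0_conjc. Qed.

(** The Laplacian of [W] is twice [y], so the claim says that [W] is harmonic; by
    [subharmonic_periodic] the inequality [0 <= y] suffices. *)
Let lapW : \sum_i D i F * D i (smooth_conj F) = - (K lam * W).
Proof.
pose y x := lam * (F x * (F x)^*%C) + \sum_i D i F x * (D i F x)^*%C.
have yE x : (\sum_i D i (D i W)) x = y x *+ 2.
  have -> : \sum_i D i (D i W) =
      (K lam * W + \sum_i D i F * D i (smooth_conj F)) *+ 2.
    transitivity ((\sum_i D i (D i F)) * smooth_conj F +
       (\sum_i D i F * D i (smooth_conj F)) *+ 2 +
       F * (\sum_i D i (D i (smooth_conj F)))).
      rewrite mulr_suml mulr_sumr -sumrMnl -!big_split; apply: eq_bigr => i _ /=.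
      rewrite [D i W]dpartialM dpartialD !dpartialM; ring.
    by rewrite lapF (laplace_conj lapF lamJ); ring.
  rewrite smooth_funMn smooth_funD smooth_fun_sum; congr ((_ + _) *+ 2).
  by apply: eq_bigr => i _; rewrite smooth_funM dpartial_conj.
(* As [lam] is nonpositive, this is the triangle inequality for the eikonal sum: its modulus is at
   most the sum of the squared moduli. *)
have y0 x : 0 <= y x.
  have lamN : lam = - `|lam| by rewrite -normrN ger0_norm // opprK.
  rewrite /y lamN mulNr addrC subr_ge0 -sqr_normc expr2 mulrA -!normrM -mulrA -eikFx.
  apply: le_trans (ler_norm_sum _ _ _) _.
  by apply: ler_sum => i _; rewrite normrM -expr2 sqr_normc.
have lap0 x : laplace w x = 0.
  apply: (subharmonic_periodic smooth_w perw) => {}x.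
  rewrite laplace_Re yE raddfMn /= mulrn_wge0 //.
  by have := y0 x; rewrite lecE => /andP[].
apply/eqP; rewrite -addr_eq0; apply/eqP/smooth_fun_ext => x.
transitivity (y x).
  rewrite smooth_funD smooth_fun_sum addrC; congr (_ + _).
  by apply: eq_bigr => i _; rewrite smooth_funM dpartial_conj.
have := lap0 x; rewrite laplace_Re yE.
rewrite raddfMn /= => /eqP; rewrite mulrn_eq0 /= => /eqP re0.
(* The order on complex numbers makes [y x] real, so its real part decides. *)
apply/eqP; rewrite eq_complex re0 eqxx /=.
by have := y0 x; rewrite lecE => /andP[].
Qed.

Lemma periodic_eigenfunction_wave :
  exists (t : V) (c : C), lam = - (Complex (dot t t) 0) /\ F = K c * wave t.
Proof. exact: unimodular_eigenfunction_wave lapF eikF lamJ lapW p Fp. Qed.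

End PeriodicEigenfunctions.

(** Reduce [x] to [y] in [0, 2 pi); there [cos y = 1 - 2 sin^2 (y / 2)], and [sin (y / 2)] is
    positive unless [y = 0]. *)
Lemma cos_eq1_int (R : realType) (x : R) : cos x = 1 -> x / (2 * pi) \is a Num.int.
Proof.
have pi0 : 0 < 2 * pi :> R by rewrite mulr_gt0 // pi_gt0.
have cosP (m : int) (y : R) : cos (y + m%:~R * (2 * pi)) = cos y.
  have E (k : nat) : k%:~R * (2 * pi) = (pi *+ 2) *+ k :> R.
    by rewrite -[X in _ = X]mulr_natl -(mulr_natl pi).
  case: m => k; first by rewrite E; exact: (periodicn (@cosD2pi R)).
  rewrite NegzE rmorphN mulNr E -[LHS](periodicn (@cosD2pi R) k.+1).
  by rewrite subrK.
move=> cx; pose m := Num.floor (x / (2 * pi)).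
pose y := x - m%:~R * (2 * pi).
have cy : cos y = 1 by rewrite -(cosP m) subrK.
have /andP[lo hi] := floor_itv (x / (2 * pi)).
rewrite -/m ler_pdivlMr // in lo; rewrite rmorphD ltr_pdivrMr // mulrDl mul1r in hi.
have y0 : 0 <= y by rewrite subr_ge0.
have y1 : y / 2 < pi by rewrite ltr_pdivrMr // /y; lra.
suff y00 : y = 0 by rewrite (subr0_eq y00) mulfK ?gt_eqF // intr_int.
move: y0; rewrite le_eqVlt => /predU1P[//|yp].
have := sin_gt0_pi (x := y / 2); rewrite divr_gt0 // y1 => /(_ isT) sp.
have : cos (y / 2 *+ 2) = 1 by rewrite -mulr_natr divfK.
rewrite cos_mulr2n cos2sin2 => c1.
have : sin (y / 2) ^+ 2 = 0 by lra.
by move=> /eqP; rewrite expf_eq0 /= gt_eqF.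
Qed.

(** * Passage between the torus and periodic functions *)

Section Torus.
Variables (R : realType) (n : nat) (G : lattice R n).
Local Notation V := 'rV[R]_n.
Local Notation C := R[i].
Local Notation M := (torus G).
Local Notation D := (@dpartial R n).
Local Notation K := (@smooth_cst R n).
Local Open Scope quotient_scope.
Implicit Types (f g : M -> C) (x : V).

Lemma pi_latticeD x k : lattice_set G k -> \pi_M (x + k) = \pi_M x.
Proof.
move=> Gk; apply/eqmodP; apply/asboolP.
by rewrite addrAC subrr add0r.
Qed.

Lemma repr_pi_lattice x : exists2 k, lattice_set G k & repr (\pi_M x) = x + k.
Proof.
have /eqmodP /asboolP Gk : repr (\pi_M x) = x %[mod M] by rewrite reprK.
by exists (repr (\pi_M x) - x); rewrite // addrC subrK.
Qed.

Lemma pullback_periodic (T : Type) (f : M -> T) : lattice_periodic G (pullback f).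
Proof. by move=> k Gk x; rewrite /pullback pi_latticeD. Qed.

(** The chosen representative differs from [x] by a lattice vector, and partial derivatives of
    periodic functions are periodic. *)
Lemma td_pi i f x : td i f (\pi_M x) = partialC i (pullback f) x.
Proof.
rewrite /td; have [k Gk ->] := repr_pi_lattice x.
have per (h : V -> R) : lattice_periodic G h -> partial i h (x + k) = partial i h x.
  move=> ph; have hk : (fun y => h (y + k)) = h by apply/funext => y; rewrite ph.
  exact: etrans (esym (congr1 (@^~ x) (partial_translate h k i)))
    (congr1 (fun u => partial i u x) hk).
by rewrite /partialC !per // => l Gl y; rewrite pullback_periodic.
Qed.

Lemma pullback_td i f : pullback (td i f) = partialC i (pullback f).
Proof. by apply/funext => x; exact: td_pi. Qed.

Lemma laplacian_pi f (sf : smoothC (pullback f)) x :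
  laplacian f (\pi_M x) = (\sum_i D i (D i (mk_smooth sf))) x.
Proof.
rewrite smooth_fun_sum; apply: eq_bigr => i _; rewrite td_pi.
rewrite (_ : pullback _ = partialC i (pullback f)) //.
by rewrite -pullback_td; apply/funext => y; rewrite /pullback mxE.
Qed.

Lemma kappa_pi f g (sf : smoothC (pullback f)) (sg : smoothC (pullback g)) x :
  kappa f g (\pi_M x) = (\sum_i D i (mk_smooth sf) * D i (mk_smooth sg)) x.
Proof.
by rewrite smooth_fun_sum; apply: eq_bigr => i _; rewrite !mxE !td_pi.
Qed.

Lemma forall_pi (P : M -> Prop) : (forall x, P (\pi_M x)) -> forall p, P p.
Proof. by move=> HP p; rewrite -[p]reprK. Qed.

Lemma wave_mul_partial (t s : V) :
  \sum_i D i (wave t) * D i (wave s) = K (- Complex (dot t s) 0) * (wave t * wave s).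
Proof.
apply: smooth_fun_ext => x; rewrite smooth_fun_sum.
transitivity (\sum_i - Complex (t 0 i * s 0 i) 0 * (wave t x * wave s x)).
  apply: eq_bigr => i _; rewrite !dpartial_wave !smooth_funM mulrACA; congr (_ * _).
  by apply/eqP; rewrite eq_complex /=; apply/andP; split; apply/eqP; ring.
rewrite -mulr_suml sumrN; congr (- _ * _).
exact: (esym (rmorph_sum (real_complex R) _ _ _)).
Qed.

Lemma wave_laplace (t : V) :
  \sum_i D i (D i (wave t)) = K (- Complex (dot t t) 0) * wave t.
Proof.
apply: smooth_fun_ext => x; rewrite smooth_fun_sum.
transitivity (\sum_i - Complex (t 0 i * t 0 i) 0 * wave t x).
  apply: eq_bigr => i _; rewrite dpartial_wave dpartialM dpartial_cst mul0r add0r.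
  rewrite dpartial_wave !smooth_funM mulrA; congr (_ * _).
  by apply/eqP; rewrite eq_complex /=; apply/andP; split; apply/eqP; ring.
rewrite -mulr_suml sumrN; congr (- _ * _).
exact: (esym (rmorph_sum (real_complex R) _ _ _)).
Qed.

Lemma dot_ge0 (t : V) : 0 <= dot t t.
Proof. by apply: sumr_ge0 => i _; rewrite -expr2 sqr_ge0. Qed.

Lemma dot_eq0 (t : V) : dot t t = 0 -> t = 0.
Proof.
move=> t0; apply/rowP => i; rewrite mxE.
have /eqP : t 0 i * t 0 i = 0.
  by apply: (psumr_eq0P _ t0) => // j _; rewrite -expr2 sqr_ge0.
by rewrite mulf_eq0 orbb => /eqP.
Qed.

Lemma dotZl (a : R) (u v : V) : dot (a *: u) v = a * dot u v.
Proof. by rewrite /dot mulr_sumr; apply: eq_bigr => i _; rewrite mxE mulrA. Qed.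

Lemma dotDl (u v w : V) : dot (u + v) w = dot u w + dot v w.
Proof. by rewrite dotC dotDr !(dotC w). Qed.

(** The substitution [t = 2 * pi * k'] absorbs all normalizing constants. *)
Lemma E_Delta_wave (lam : C) f : E_Delta lam f <->
  exists t : V, [/\ dual_lattice G ((2 * pi)^-1 *: t),
    lam = - Complex (dot t t) 0 & pullback f = wave t].
Proof.
have pi0 : 2 * pi != 0 :> R by rewrite mulf_neq0 // gt_eqF // pi_gt0.
have cexpE (t x : V) :
    cexp ((2 * pi)%:C%C * 'i%C * (dot ((2 * pi)^-1 *: t) x)%:C%C) = wave t x.
  rewrite dotZl /cexp.
  have -> : (2 * pi)%:C%C * 'i%C * ((2 * pi)^-1 * dot t x)%:C%C = Complex 0 (dot t x).
    apply/eqP; rewrite eq_complex /=; apply/andP; split; apply/eqP; first by ring.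
    by rewrite !mul0r !mulr0 !add0r !addr0 mulr1 mulVKf.
  by rewrite /= expR0 mul1r.
have pi20 : (4 * pi ^+ 2)%:C%C != 0 :> C.
  by rewrite eq_complex /= negb_and mulf_neq0 // expf_neq0 // gt_eqF // pi_gt0.
have lamE (t : V) : lam = - Complex (dot t t) 0 <->
    (enorm ((2 * pi)^-1 *: t) ^+ 2)%:C%C = - lam / (4 * pi ^+ 2)%:C%C.
  rewrite /enorm sqr_sqrtr ?dot_ge0 // dotZl (dotC t (_ *: _)) dotZl.
  have fld (q d : R) : q != 0 -> (2 * q)^-1 * ((2 * q)^-1 * d) = d / (4 * q ^+ 2).
    by move=> q0; field.
  rewrite fld ?gt_eqF ?pi_gt0 //.
  rewrite rmorphM fmorphV; split=> [->|/(mulIf _) E]; first by rewrite opprK.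
  by rewrite -[LHS]opprK -E // invr_neq0.
split=> [[k [Gk kE fE]]|[t [Gt tE fE]]].
  have kt : k = (2 * pi)^-1 *: ((2 * pi) *: k) by rewrite scalerA mulVf ?scale1r.
  exists ((2 * pi) *: k); rewrite -kt; split=> //.
    by apply/lamE; rewrite -kt.
  by apply/funext => x; rewrite -cexpE -kt /pullback fE.
exists ((2 * pi)^-1 *: t); split=> //; first exact/lamE.
by move=> x; rewrite cexpE -fE.
Qed.

End Torus.

(** * Eigenfunctions and eigenfamilies on the torus *)

Section Eigenfamilies.
Variables (R : realType) (n : nat) (G : lattice R n).
Local Notation V := 'rV[R]_n.
Local Notation C := R[i].
Local Notation M := (torus G).
Local Notation K := (@smooth_cst R n).
Local Open Scope quotient_scope.

Lemma E_Delta_eigenfunction (lam : C) (f : M -> C) :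
  E_Delta lam f -> eigenfunction lam lam f.
Proof.
move=> /E_Delta_wave[t [_ -> fE]].
have sf : smoothC (pullback f) by rewrite fE; exact: smooth_funP.
have FE : mk_smooth sf = wave t by apply: smooth_fun_ext => x /=; rewrite fE.
have fx x : f (\pi_M x) = wave t x by rewrite -fE.
split=> //; apply: forall_pi => x.
  by rewrite laplacian_pi FE wave_laplace fx.
by rewrite (kappa_pi sf sf) FE wave_mul_partial fx.
Qed.

(** The equality [lam = mu] comes first: the rigidity lemma expects the same constant in both
    equations. *)
Lemma eigenfunction_wave (lam mu : C) (f : M -> C) p :
  eigenfunction lam mu f -> f p != 0 ->
  lam = mu /\ exists (t : V) (c : C),
    lam = - Complex (dot t t) 0 /\ forall x, f (\pi_M x) = c * wave t x.
Proof.
move=> [sf lapf eikf] fp; pose F := mk_smooth sf.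
have Fp : F (repr p) != 0 by rewrite /= /pullback reprK.
have lapF : \sum_i dpartial i (dpartial i F) = K lam * F.
  by apply: smooth_fun_ext => x; rewrite -laplacian_pi lapf.
have eikF : \sum_i dpartial i F * dpartial i F = K mu * F ^+ 2.
  by apply: smooth_fun_ext => x; rewrite -kappa_pi eikf.
have lm := eikonal_eigenvalue Fp lapF eikF; split=> //.
rewrite -lm in eikF.
have perF : lattice_periodic G F := pullback_periodic f.
have [t [c [lamE FE]]] := periodic_eigenfunction_wave perF Fp lapF eikF.
exists t, c; split=> // x.
by rewrite -[LHS]/(F x) FE.
Qed.

(** Comparing real parts at [0] and at [k] gives [cos (dot t k) = 1]. *)
Lemma wave_dual (t : V) : lattice_periodic G (wave t) ->
  dual_lattice G ((2 * pi)^-1 *: t).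
Proof.
move=> per k Gk; rewrite dotC dotZl mulrC; apply: cos_eq1_int.
have t0 : dot t 0 = 0 by rewrite dotC -(scale0r 0) dotZl mul0r.
have := per k Gk 0; rewrite add0r => -[-> _].
by rewrite t0 cos0.
Qed.

(** The difference [t - s] is orthogonal to both [s] and [t], hence to itself. *)
Lemma dot_eq (t s : V) : dot t t = dot s s -> dot t s = dot t t -> t = s.
Proof.
move=> ts tt; apply: subr0_eq; apply: dot_eq0.
have E : dot (t - s) s = 0.
  by apply: (addIr (dot s s)); rewrite -dotDl subrK add0r tt.
have E' : dot (t - s) (t - s) + dot (t - s) s = dot (t - s) t.
  by rewrite -dotDr subrK.
rewrite E addr0 in E'; rewrite E'; apply: (addIr (dot s t)).
by rewrite -dotDl subrK add0r (dotC s t) tt.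
Qed.

(** All nonzero members are multiples of waves with frequencies of equal length; the mixed condition
    on [kappa] fixes the inner product of two frequencies and so forces them to agree. *)
Lemma eigenfamily_collinear (lam mu : C) (Fam : set (M -> C)) phi :
  eigenfamily lam mu Fam -> Fam phi -> (exists p, phi p != 0) ->
  lam = mu /\ exists2 f, E_Delta lam f &
    (exists2 c, c != 0 & f = fun p => c * phi p) /\
    (forall psi, Fam psi -> exists b, psi = fun p => b * f p).
Proof.
move=> [smF lapF kapF] Fphi [p phip].
have eig psi : Fam psi -> eigenfunction lam mu psi.
  move=> Fpsi; split=> [|q|q]; [exact: smF|exact: lapF|].
  by rewrite kapF // expr2.
have [lm [t [c [lamt phiE]]]] := eigenfunction_wave (eig _ Fphi) phip.
split=> //.
have c0 : c != 0.
  apply: contra_neq phip => c0; move: p; apply: forall_pi => x.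
  by rewrite phiE c0 mul0r.
have wave0 (s : V) x : wave s x != 0.
  apply: contraTneq isT => ws; have := wave_conj s x.
  by rewrite ws mulr0 => /eqP; rewrite eq_sym oner_eq0.
(* Dividing by the amplitude leaves the bare wave, which inherits periodicity from [phi]; this puts
   its frequency in the scaled dual lattice. *)
pose f q := c^-1 * phi q.
have fE x : f (\pi_M x) = wave t x by rewrite /f phiE mulKf.
exists f.
  apply/E_Delta_wave; exists t; split=> //; last by apply/funext => x; exact: fE.
  by apply: wave_dual => k Gk x; rewrite -!fE pi_latticeD.
split; first by exists c^-1 => //; rewrite invr_neq0.
move=> psi Fpsi; have [[q psiq]|psi0] := pselect (exists q, psi q != 0); last first.
  (* The zero function may belong to the family; it has no frequency of its own. *)
  exists 0; apply/funext => q; rewrite mul0r.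
  by apply/eqP/negPn/negP => psiq; apply: psi0; exists q.
have [_ [s [b [lams psiE]]]] := eigenfunction_wave (eig _ Fpsi) psiq.
exists b; apply: funext; apply: forall_pi => x; rewrite psiE fE.
suff -> : t = s by [].
have ts : dot t t = dot s s.
  by move: lams; rewrite lamt => /oppr_inj[].
apply: dot_eq => //.
have b0 : b != 0.
  apply: contra_neq psiq => b0; move: q; apply: forall_pi => y.
  by rewrite psiE b0 mul0r.
have sphi := smF _ Fphi; have spsi := smF _ Fpsi.
have phiK : mk_smooth sphi = K c * wave t by apply: smooth_fun_ext => y; exact: phiE.
have psiK : mk_smooth spsi = K b * wave s by apply: smooth_fun_ext => y; exact: psiE.
(* Waves never vanish, so the condition at the single point [0] already determines [dot t s]. *)
have := kapF _ _ Fphi Fpsi (\pi_M 0); rewrite (kappa_pi sphi spsi) phiK psiK.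
have -> : \sum_i dpartial i (K c * wave t) * dpartial i (K b * wave s) =
    K c * K b * \sum_i dpartial i (wave t) * dpartial i (wave s).
  rewrite mulr_sumr; apply: eq_bigr => i _.
  rewrite !dpartialM !dpartial_cst; ring.
rewrite wave_mul_partial phiE psiE -lm lamt => E.
have {}E : - Complex (dot t s) 0 * (c * b * (wave t 0 * wave s 0)) =
    - Complex (dot t t) 0 * (c * b * (wave t 0 * wave s 0)).
  transitivity (c * b * (- Complex (dot t s) 0 * (wave t 0 * wave s 0))); first by ring.
  by apply: etrans E _; ring.
have N0 : c * b * (wave t 0 * wave s 0) != 0 by rewrite !mulf_neq0.
by have /oppr_inj[] := mulIf N0 E.
Qed.

End Eigenfamilies.

(** * One-dimensional spans *)

Section Spans.
Variables (T : Type) (k : fieldType).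

Lemma lin_span1P (f g : T -> k) :
  lin_span [set f] g <-> exists a, g = fun p => a * f p.
Proof.
split=> [[m [c [h [hE ->]]]]|[a ->]].
  exists (\sum_i c i); apply/funext => p; rewrite mulr_suml.
  by apply: eq_bigr => i _; rewrite (hE i).
exists 1%N, (fun _ => a), (fun _ => f); split=> //.
by apply/funext => p; rewrite big_ord1.
Qed.

(** The generator [f] may lie outside [F]; it enters the span through [phi]. *)
Lemma lin_span_collinear (F : set (T -> k)) phi f c : F phi -> c != 0 ->
  f = (fun p => c * phi p) -> (forall psi, F psi -> exists b, psi = fun p => b * f p) ->
  lin_span F = lin_span [set f].
Proof.
move=> Fphi c0 fE Ff; apply/seteqP; split=> g.
  move=> [m [a [h [Fh ->]]]]; apply/lin_span1P.
  have /choice[b hE] : forall i, exists b, h i = fun p => b * f p.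
    by move=> i; exact: Ff.
  exists (\sum_i a i * b i); apply/funext => p; rewrite mulr_suml.
  by apply: eq_bigr => i _; rewrite hE mulrA.
move=> /lin_span1P[a ->].
exists 1%N, (fun _ => a * c), (fun _ => phi); split=> //.
by apply/funext => p; rewrite big_ord1 fE mulrA.
Qed.

Lemma has_dim1_lin_span (f : T -> k) p : f p != 0 -> has_dim 1 (lin_span [set f]).
Proof.
move=> fp; exists (fun _ => f); split=> [c c0 i|].
  have /eqP := c0 p; rewrite big_ord1 mulf_eq0 (negPf fp) orbF => /eqP.
  by rewrite (ord1 i).
congr lin_span; apply/seteqP; split=> [_ ->|_ [_ _ <-]] //.
by exists ord0.
Qed.

End Spans.

(** In the second part the nonzero member [phi] rules out families without nonzero functions: these
    satisfy the equations for all [lambda] and [mu], but their span is zero. *)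
Theorem theorem4 (R : realType) (n : nat) (Gamma : lattice R n) :
  (forall lambda : R[i], spectrum Gamma lambda ->
    forall f : torus Gamma -> R[i], E_Delta lambda f ->
      eigenfunction lambda lambda f) /\
  (forall (lambda mu : R[i]) (F : set (torus Gamma -> R[i])),
    (exists2 phi, F phi & exists p, phi p != 0) ->
    eigenfamily lambda mu F ->
    spectrum Gamma lambda /\
    (exists2 f, E_Delta lambda f & lin_span F = lin_span [set f]) /\
    lambda = mu /\
    has_dim 1 (lin_span F)).
Proof.
split=> [lambda _ f|lambda mu F [phi Fphi [p phip]] famF].
  exact: E_Delta_eigenfunction.
have [lm [f Ef [[c c0 fE] Ff]]] := eigenfamily_collinear famF Fphi (ex_intro _ p phip).
have spanE := lin_span_collinear Fphi c0 fE Ff.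
split; [|split; [|split]] => //.
- by case: famF => smF lapF _; exists phi; split; [exact: smF|exists p|exact: lapF].
- by exists f.
- by rewrite spanE; apply: (@has_dim1_lin_span _ _ _ p); rewrite fE mulf_neq0.
Qed.
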